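(* Consider scale invariant measures $\mu$ (with cutoff $1$) on the collection $\mathfrak{G}$ of subsets of $\mathbb{R}^d$ of diameter smaller than $1$, each constructed from a finite measure $\nu_o$ on sets of diameter $1$ anchored at the origin as described in the context. For such $\mu$ consider the three properties (B) $\mu(\{G\in\mathfrak{G}:\mathcal{L}(\partial G)>0\})=0$; (I) $\displaystyle\int_{\mathcal{A}_1}\int_0^1\frac1r\,\frac{\mathcal{L}([\partial G]^r)}{\mathcal{L}(G)}\,dr\,d\mu_p(G)<\infty$; (T) $\mu$ is thin, i.e. $\displaystyle\int_0^1\frac1r\int\mathcal{L}\big(E(H,r)\setminus S(H,r)\big)\,d\nu_o(H)\,dr<\infty$. Then: (i) If $\mu$ is thin (T), then (B) and (I) are both satisfied. (ii) If $\mu$ is supported on compact sets, then (I) implies (B); for general measures $\mu$ this is not the case, i.e. there exists a measure $\mu$ satisfying (I) but not (B). (iii) (B) does not imply (I), i.e. there exists a measure $\mu$ satisfying (B) but not (I).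
   Context: $\mathcal{L}$ is Lebesgue measure on $\mathbb{R}^d$, $\partial G$ is the topological boundary of $G$, $o$ is the origin, $\mathfrak{G}=\{G\subset\mathbb{R}^d:\mathrm{diam}(G)<1\}$, equipped with a suitable $\sigma$-algebra $\mathcal{F}$ (one for which all the subsets of $\mathfrak{G}$ and functions considered are measurable). Construction of $\mu$: let $L(H)$ denote the center of mass of $H$ (it only serves as an anchor point for $H$; any other such anchor would do). Let $\nu_o$ be a finite measure on sets $H\subset\mathbb{R}^d$ with $\mathrm{diam}(H)=1$ and $L(H)=o$. The measure $\mu$ is given by $$\int F(G)\,d\mu(G)=\int_{\mathbb{R}^d}\int_0^1\int F(\rho H+x)\,d\nu_o(H)\,\rho^{-(d+1)}\,d\rho\,\mathcal{L}(dx)$$ for $F$ in a suitable class of functions (e.g. nonnegative measurable). Every scale and translation invariant measure considered (locally finite in the sense that $\mu(\{G: G\cap A\ne\emptyset,\mathrm{diam}(G)\ge\delta\})<\infty$ for all bounded $A$ and $\delta>0$) can be constructed in this way. Notation: $\mathcal{A}_1=\{G\in\mathfrak{G}: o\in G,\ 2^{-1}\leq\mathrm{diam}(G)<1\}$; $\mu_p(\mathcal{A})=\mu(\{G\in\mathcal{A}:\mathcal{L}(G)>0\})$ for $\mathcal{A}\in\mathcal{F}$; $[\partial G]^r=\{x\in G: d(x,\partial G)<r\}$; $E(H,r)=\{x\in\mathbb{R}^d: d(x,H)<r\}$; $S(H,r)=\{x\in H: d(x,\partial H)\geq r\}$. ''$\mu$ is supported on compact sets'' means that $\mu$-almost every $G$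 is compact. *)

(* Defs.v *)
From HB Require Import structures.
From mathcomp Require Import all_boot all_order all_algebra.
From mathcomp Require Import all_classical all_reals all_analysis.
From mathcomp Require Import measurable_realfun.

Set Implicit Arguments.
Unset Strict Implicit.
Unset Printing Implicit Defensive.

Import Order.TTheory GRing.Theory Num.Theory.
Import numFieldNormedType.Exports.

Local Open Scope classical_set_scope.
Local Open Scope ring_scope.

Section lebesgue_measure_Rd.
Context (R : realType) (n : nat).
Local Notation d := n.+1.
Local Notation vec := 'rV[R]_d.

Definition box (ab : vec * vec) : set vec :=
  [set x | forall i, ab.1 ord0 i < x ord0 i <= ab.2 ord0 i].

Definition box_volume (ab : vec * vec) : R :=
  \prod_(i < d) Num.max 0 (ab.2 ord0 i - ab.1 ord0 i).

Definition leb_outer (A : set vec) : \bar R :=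
  ereal_inf [set (\sum_(k <oo) (box_volume (I k))%:E)%E |
             I in [set I : nat -> vec * vec | A `<=` \bigcup_k box (I k)]].

Let volE_ge0 ab : (0 <= (box_volume ab)%:E)%E.
Proof. by rewrite lee_fin prodr_ge0// => i _; rewrite le_max lexx. Qed.

Let leb_outer_ge0 A : (0 <= leb_outer A)%E.
Proof.
by apply: le_ereal_inf_tmp => _ [I _ <-]; apply: nneseries_ge0 => k _ _.
Qed.

Let leb_outer0 : leb_outer set0 = 0%E.
Proof.
apply/eqP; rewrite eq_le leb_outer_ge0 andbT; apply: ereal_inf_lbound.
exists (fun=> (0, 0)) => //=; apply: eseries0 => k _ _.
by rewrite /box_volume big_ord_recl /= !mxE subrr maxxx mul0r.
Qed.

Let le_leb_outer : {homo leb_outer : A B / A `<=` B >-> (A <= B)%E}.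
Proof.
move=> A B AB; apply/ereal_inf_le_tmp => x [I BI <-].
by exists I => //; exact: subset_trans AB BI.
Qed.

Let leb_outer_sigma_subadditive : sigma_subadditive leb_outer.
Proof.
move=> A; have [[i ioo]|] := pselect (exists i, leb_outer (A i) = +oo%E).
  rewrite (eseries_pinfty _ _ ioo) ?leey// => k _.
  by rewrite -ltNye (lt_le_trans _ (leb_outer_ge0 _)).
rewrite -forallNE => Aoo.
suff add2e (e : {posnum R}) :
    (leb_outer (\bigcup_k A k) <= \sum_(i <oo) leb_outer (A i) + e%:num%:E)%E.
  by apply/lee_addgt0Pr => _/posnumP[].
rewrite (le_trans _ (epsilon_trick _ _ _))//.
pose P k (B : nat -> vec * vec) := A k `<=` \bigcup_j box (B j) /\
  (\sum_(j <oo) (box_volume (B j))%:E <=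
    leb_outer (A k) + (e%:num / (2 ^ k.+1)%:R)%:E)%E.
have [G PG] : {G : nat -> nat -> vec * vec & forall k, P k (G k)}.
  apply: (@choice _ _ P) => k; rewrite /P /leb_outer.
  set S := (X in ereal_inf X); move infS : (ereal_inf S) => iS.
  case: iS infS => [r Sr|Soo|Soo].
  - have en1 : 0 < e%:num / (2 ^ k.+1)%:R by [].
    have /(lb_ereal_inf_adherent en1) : ereal_inf S \is a fin_num by rewrite Sr.
    move=> [x [B AkB muBx] xS].
    by exists B; split => //; rewrite muBx -Sr; exact/ltW.
  - by have := Aoo k; rewrite /leb_outer Soo.
  - by have := leb_outer_ge0 (A k); rewrite /leb_outer -/S Soo.
pose v ij := (box_volume (uncurry G ij))%:E.
have v_ge0 x : (0 <= v x)%E by exact: volE_ge0.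
apply: (@le_trans _ _ (\esum_(i in setT) v i)).
  apply: ereal_inf_lbound => /=.
  have /card_esym/ppcard_eqP[f] := card_nat2.
  exists (uncurry G \o f).
    move=> t [i _] /(PG i).1 [j _ Bijt]; exists (f^-1%FUN (i, j)) => //=.
    by rewrite invK ?inE.
  rewrite -(esum_pred_image v _ xpredT) ?[fun=> _]set_true//.
  by rewrite image_eq.
rewrite (_ : esum _ _ = \sum_(i <oo) \sum_(j <oo) v (i, j))%E; last first.
  pose J : nat -> set (nat * nat) := fun i => [set (i, j) | j in setT].
  rewrite (_ : setT = \bigcup_k J k); last first.
    by rewrite predeqE => -[a b]; split => // _; exists a => //; exists b.
  rewrite esum_bigcupT /=; last 2 first.
    - apply/trivIsetP => i j _ _ ij.
      rewrite predeqE => -[k m] /=; split => //= -[] [_] _ [<-{k} _].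
      by move=> [m' _] [] /esym/eqP; rewrite (negbTE ij).
    - by [].
  rewrite -(image_id [set: nat]) -fun_true esum_pred_image//; last first.
    by move=> k _; exact: esum_ge0.
  apply: eq_eseriesr => /= j _.
  rewrite -(esum_pred_image v (pair j) predT)//=; last first.
    by move=> ? ? _ _; exact: (@can_inj _ _ _ snd).
  by congr esum; rewrite predeqE => -[a b]; split; move=> [i _ <-]; exists i.
apply: lee_lim.
- by apply: is_cvg_nneseries => k *; apply: nneseries_ge0.
- by apply: is_cvg_nneseries => k *; apply: adde_ge0.
- by near=> k; apply: lee_sum => i _; exact: (PG i).2.
Unshelve. all: by end_near. Qed.

HB.instance Definition _ := isOuterMeasure.Build R vec leb_outer
  leb_outer0 leb_outer_ge0 le_leb_outer leb_outer_sigma_subadditive.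

End lebesgue_measure_Rd.

(* [caratheodory_type leb_outer] is 'rV[R]_n.+1 with the sigma-algebra of
   Lebesgue measurable sets, on which [leb_outer] is a complete measure.  As a
   function, [lebesgue_Rd] is total: it is the outer measure of any set. *)
Definition Rd (R : realType) (n : nat) := caratheodory_type (@leb_outer R n).

HB.instance Definition _ (R : realType) (n : nat) := Measurable.on (Rd R n).

Definition lebesgue_Rd (R : realType) (n : nat) : set (Rd R n) -> \bar R :=
  @leb_outer R n.

HB.instance Definition _ (R : realType) (n : nat) :=
  isMeasure.Build _ (Rd R n) R (@lebesgue_Rd R n)
    (@caratheodory_measure0 R _ (@leb_outer R n))
    (@caratheodory_measure_ge0 R _ (@leb_outer R n))
    (@caratheodory_measure_sigma_additive R _ (@leb_outer R n)).

Section euclidean_geometry.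
Context (R : realType) (n : nat).
Local Notation vec := 'rV[R]_n.+1.

(* The norm [`|x|] of the library on row vectors is the maximum norm; both
   norms induce the same topology, hence the same closures and interiors. *)
Definition euclid_norm (x : vec) : R := Num.sqrt (\sum_i x ord0 i ^+ 2).

Definition diam (A : set vec) : \bar R :=
  ereal_sup (0%E |` [set (euclid_norm (x - y))%:E | x in A & y in A]).

Definition dist (x : vec) (A : set vec) : \bar R :=
  ereal_inf [set (euclid_norm (x - y))%:E | y in A].

Definition boundary (A : set vec) : set vec := closure A `\` interior A.

Definition inner_collar (G : set vec) (r : R) : set vec :=
  [set x | G x /\ (dist x (boundary G) < r%:E)%E].

Definition outer_parallel (H : set vec) (r : R) : set vec :=
  [set x | (dist x H < r%:E)%E].

Definition inner_parallel (H : set vec) (r : R) : set vec :=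
  [set x | H x /\ (r%:E <= dist x (boundary H))%E].

Definition homothet (rho : R) (x : vec) (H : set vec) : set vec :=
  [set rho *: h + x | h in H].

(* The only property of the centre of mass that the construction uses, required
   where the centre of mass is meant: on nonempty bounded sets.  It has to be
   given for Lebesgue-null sets as well, where there is no canonical centre. *)
Definition anchor (L : set vec -> vec) : Prop :=
  forall (rho : R) (x : vec) (H : set vec),
    0 < rho -> H !=set0 -> (diam H < +oo)%E ->
    L (homothet rho x H) = rho *: L H + x.

Lemma anchor_lower_corner :
  anchor (fun H : set vec => \row_i inf [set x ord0 i | x in H]).
Proof.
move=> rho c H rho_gt0 [h0 Hh0] diamH; apply/rowP => i; rewrite !mxE.
pose A := [set x ord0 i | x in H].
have A0 : A !=set0 by exists (h0 ord0 i), h0.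
have Alb : has_lbound A.
  exists (h0 ord0 i - fine (diam H)) => _ [x Hx <-].
  have dE : diam H \is a fin_num.
    by rewrite ge0_fin_numE//; apply: ereal_sup_ubound; left.
  have le_dist : `|h0 ord0 i - x ord0 i| <= euclid_norm (h0 - x).
    rewrite -sqrtr_sqr; apply: ler_wsqrtr; rewrite (bigD1 i)//= !mxE.
    by rewrite lerDl sumr_ge0// => j _; exact: sqr_ge0.
  suff : euclid_norm (h0 - x) <= fine (diam H).
    by move/(le_trans le_dist)/(le_trans (ler_norm _)); rewrite !lerBlDr addrC.
  rewrite -lee_fin fineK//; apply: ereal_sup_ubound; right.
  by exists h0 => //; exists x.
have Blb y : homothet rho c H y -> rho * inf A + c ord0 i <= y ord0 i.
  move=> [x Hx <-]; rewrite !mxE lerD2r ler_pM2l//.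
  by apply: ge_inf => //; exists x.
apply/eqP; rewrite eq_le; apply/andP; split; last first.
  apply: lb_le_inf.
    by exists ((rho *: h0 + c) ord0 i), (rho *: h0 + c) => //; exists h0.
  by move=> _ [y By <-]; exact: Blb.
rewrite -lerBlDr mulrC -ler_pdivrMr//; apply: lb_le_inf => // _ [x Hx <-].
rewrite ler_pdivrMr// lerBlDr; apply: ge_inf.
  by exists (rho * inf A + c ord0 i) => _ [y By <-]; exact: Blb.
by exists (rho *: x + c); [exists x | rewrite !mxE mulrC].
Qed.

End euclidean_geometry.

(* The type of all subsets of R^d with the sigma-algebra [F].  Both [nu] and [mu]
   live on it, [nu] being carried by sets of diameter 1 and [mu] by
   [small_sets]. *)
Notation sets F := (g_sigma_algebraType F).

Section scale_invariant_measures.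
Context (R : realType) (n : nat).
Local Notation d := n.+1.
Local Notation vec := 'rV[R]_d.
Local Notation leb := (@lebesgue_Rd R n).
Implicit Types F : set (set (set vec)).

Definition small_sets : set (set vec) := [set G | (diam G < 1)%E].

(* No sigma-algebra on all subsets of R^d makes (H, rho, x) |-> rho H + x and
   the event that o belongs to G measurable, as every H would then be Lebesgue
   measurable.  The map is therefore only asked to be measurable off a set [N]
   that is null for the product of [nu] and the Lebesgue measures. *)
Record suitable F (nu : set (sets F) -> \bar R) : Prop := Suitable {
  suitable_sigma_algebra : sigma_algebra setT F ;
  suitable_diam : measurable_fun setT (fun G : sets F => diam G) ;
  suitable_origin : measurable ([set G : set vec | G 0] : set (sets F)) ;
  suitable_compact :
    measurable ([set G : set vec | compact G] : set (sets F)) ;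
  suitable_volume : measurable_fun setT (fun G : sets F => leb G) ;
  suitable_boundary :
    measurable_fun setT (fun G : sets F => leb (boundary G)) ;
  suitable_collar : forall r : R, 0 < r ->
    measurable_fun setT (fun G : sets F => leb (inner_collar G r)) ;
  suitable_parallel : forall r : R, 0 < r ->
    measurable_fun setT
      (fun H : sets F => leb (outer_parallel H r `\` inner_parallel H r)) ;
  suitable_homothet : exists N : set (sets F * R * Rd R n),
    [/\ measurable N,
        (\int[leb]_x \int[lebesgue_measure]_(rho in `]0%R, 1%R[)
           nu [set H | N (H, rho, x)] = 0)%E &
        measurable_fun ([set p | 0 < p.1.2 < 1] `\` N)
          (fun p : sets F * R * Rd R n =>
             homothet p.1.2 p.2 p.1.1 : sets F)]
}.

Record scale_invariant (L : set vec -> vec) F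
    (nu : {finite_measure set (sets F) -> \bar R})
    (mu : {measure set (sets F) -> \bar R}) : Prop := ScaleInvariant {
  scale_invariant_suitable : suitable nu ;
  scale_invariant_carrier : {ae nu, forall H : sets F, diam H = 1%E /\ L H = 0} ;
  scale_invariant_formula : forall f : sets F -> \bar R,
    measurable_fun setT f -> (forall G, 0 <= f G)%E ->
    (\int[mu]_G f G =
     \int[leb]_x \int[lebesgue_measure]_(rho in `]0%R, 1%R[)
       ((\int[nu]_H f (homothet rho x H)) * (rho ^- d.+1)%:E))%E
}.

Section properties.
Context F (mu : set (sets F) -> \bar R) (nu : set (sets F) -> \bar R).

Definition A1 : set (sets F) :=
  [set G : set vec | small_sets G /\ G 0 /\ (2^-1%:E <= diam G < 1)%E].

(* It is [mrestr mu mV], whatever the proof [mV] that the set of the [G] of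
   positive volume is measurable. *)
Definition mu_p : set (sets F) -> \bar R :=
  fun A => mu (A `&` [set G | (0 < leb G)%E]).

Definition null_boundary : Prop :=
  mu [set G | small_sets G /\ (0 < leb (boundary G))%E] = 0%E.

Definition collar_integrable : Prop :=
  (\int[mu_p]_(G in A1) \int[lebesgue_measure]_(r in `]0%R, 1%R[)
     (r^-1%:E * (leb (inner_collar G r) / leb G)) < +oo)%E.

Definition thin : Prop :=
  (\int[lebesgue_measure]_(r in `]0%R, 1%R[)
     (r^-1%:E *
      \int[nu]_H leb (outer_parallel H r `\` inner_parallel H r)) < +oo)%E.

Definition compactly_supported : Prop :=
  mu.-negligible [set G : set vec | ~ compact G].

End properties.
End scale_invariant_measures.

(* Main.v *)
(** For every [r > 0], [E(H, r) \ S(H, r)] contains the boundary of [H] and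
    the inner collar of [H] of width [r].

    Thinness thus gives [L(bd H) = 0] for almost all [H], as [1 / r] is not
    integrable near 0, and scale invariance transports null events that are
    stable under homotheties between [nu_o] and [mu]: this is (B).  For (I), the
    [x] with [o \in rho H + x] fill a reflected copy of [rho H], whose volume
    cancels the denominator [L(G)]; what remains is the integral of the collars
    of width at most [2 r] of [H].

    A compact [G] contains its boundary, hence so do all its collars, and the
    inner integral of (I) diverges as soon as [L(bd G) > 0]; the same
    cancellation of volumes turns the finiteness of (I) into [L(bd H) = 0] for
    [nu_o]-almost all [H].

    For the counterexamples [nu_o] is a unit mass at a rescaled copy of
    [{x \in (0, 1)^d | x_1 \in T}].  If [T] is the set of the rationals, the
    volume vanishes whereas the boundary is the closed cube.  If [T] is the
    complement of the points [1 / (1 + log k)], the boundary is null, but the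
    collar of width [1 / k] contains the part where [x_1 < 1 / (1 + log k)], so
    that (I) diverges like the integral of [1 / (r log (1 / r))]. *)

Require Import Defs.
From HB Require Import structures.
From mathcomp Require Import all_boot all_order all_algebra.
From mathcomp Require Import all_classical all_reals all_analysis.
From mathcomp Require Import measurable_realfun.
From mathcomp Require Import lra ring zify.

Set Implicit Arguments.
Unset Strict Implicit.
Unset Printing Implicit Defensive.

Import Order.TTheory GRing.Theory Num.Theory.
Import numFieldNormedType.Exports.

Local Open Scope classical_set_scope.
Local Open Scope ring_scope.

(** * Integration *)

(** The formula for [mu] has the integral over [H] innermost, whereas the cancellation of volumes
    needs [x] innermost, with [H] and [rho] fixed. Tonelli is obstructed: the homothety is jointly
    measurable only off a null set. The proof therefore integrates over a measurable set [E] of full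
    measure in the strip [0 < rho < 1], and compares with the original formula by estimates of lower
    integrals, which hold for arbitrary nonnegative functions. Measurability of the volumes of
    collars is given only for each fixed width; as these volumes are monotone in [r], integrals
    against [dr / r] are compared with sums over [r = 2^-k]. Volumes of arbitrary sets are outer
    measures and are handled through covers by boxes; factors such as [2 ^ d] are lost freely, since
    only finiteness and nullity matter. For the counterexamples the sigma-algebra is chosen after
    the shape, as the largest one for which the copies of this shape depend measurably on
    [(x, rho)]. *)

Section lower_integral.
Local Open Scope ereal_scope.
Context d (T : measurableType d) (R : realType).
Variable m : {measure set T -> \bar R}.
Implicit Types (f g : T -> \bar R) (Z : set T).

Import HBNNSimple.

(* The integral of a nonnegative function is a supremum over the simple
   functions below it, whence the absence of measurability hypotheses. *)
Lemma ge0_le_integral_off Z f g : measurable Z -> m Z = 0 ->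
  (forall x, 0 <= f x) -> (forall x, 0 <= g x) ->
  (forall x, ~ Z x -> f x <= g x) -> \int[m]_x f x <= \int[m]_x g x.
Proof.
move=> mZ Z0 f0 g0 fg; rewrite ge0_integralTE// [leRHS]ge0_integralTE//.
apply: ge_ereal_sup => _ [h/= hf <-].
have mhZ : measurable (~` Z) by exact: measurableC.
(* On [Z] the simple function [h] may exceed [g]. Setting it to 0 there keeps its integral, as [Z]
   is null, and puts it below [g] everywhere. *)
have -> : sintegral m h = sintegral m (proj_nnsfun h mhZ).
  rewrite -!integralT_nnsfun; apply: ge0_ae_eq_integral => //.
  - by apply/measurable_EFinP; exact: measurable_funPT.
  - exact/measurable_EFinP.
  - by move=> x _; rewrite lee_fin.
  - by move=> x _; rewrite lee_fin.
  exists Z; split => // x /= /not_implyP[_]; apply: contra_notP => Zx.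
  by rewrite /= mindicE mem_set// mulr1.
apply: ereal_sup_ubound; exists (proj_nnsfun h mhZ) => //= x.
rewrite mindicE; have [|_] := boolP (x \in _); last by rewrite mulr0.
by rewrite mulr1 inE => Zx; exact: le_trans (hf x) (fg _ Zx).
Qed.

Lemma ge0_le_integralT f g : (forall x, 0 <= f x) ->
  (forall x, f x <= g x) -> \int[m]_x f x <= \int[m]_x g x.
Proof.
move=> f0 fg; apply: (@ge0_le_integral_off set0) => // x.
exact: le_trans (f0 x) (fg x).
Qed.

Lemma ge0_le_integral_in (D : set T) f g : (forall x, D x -> 0 <= f x) ->
  (forall x, D x -> f x <= g x) ->
  \int[m]_(x in D) f x <= \int[m]_(x in D) g x.
Proof.
move=> f0 fg; rewrite integral_mkcond [leRHS]integral_mkcond.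
apply: ge0_le_integralT => x; rewrite !patchE; case: ifPn => //; rewrite inE.
- exact: f0.
- exact: fg.
Qed.

Lemma integral0_ae f : measurable_fun setT f -> (forall x, 0 <= f x) ->
  \int[m]_x f x = 0 ->
  exists Z, [/\ measurable Z, m Z = 0 & forall x, ~ Z x -> f x = 0].
Proof.
move=> mf f0 If; have : \int[m]_x `|f x| = 0.
  by rewrite -[RHS]If; apply: eq_integral => x _; rewrite gee0_abs.
move/(ae_eq_integral_abs _ measurableT mf) => [Z [mZ Z0 fZ]].
exists Z; split => // x nZ; apply: contrapT => fx; apply/nZ/fZ => /=.
by move=> /(_ I).
Qed.

Lemma integral_infty_set (E : set T) f : measurable E ->
  (forall x, 0 <= f x) -> (forall x, E x -> f x = +oo) ->
  \int[m]_x f x < +oo -> m E = 0.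
Proof.
move=> mE f0 fE; apply: contraPP => /eqP E0; apply/negP; rewrite -leNgt.
rewrite (@le_trans _ _ (\int[m]_(x in E) (cst +oo) x))//.
  by rewrite integral_cst// gt0_mulye// lt0e E0/=.
rewrite integral_mkcond; apply: ge0_le_integralT => x; rewrite patchE.
  by case: ifPn => // _; exact: le0y.
by case: ifPn => [|_]; [rewrite inE => /fE ->|exact: f0].
Qed.

Lemma integral_mrestr (D : set T) (mD : measurable D) f :
  measurable_fun setT f -> (forall x, 0 <= f x) ->
  \int[mrestr m mD]_x f x = \int[m]_(x in D) f x.
Proof.
move=> mf f0; have mDc : measurable (~` D) by exact: measurableC.
rewrite (@ge0_negligible_integral _ _ _ _ setT (~` D))//; last first.
  by rewrite /= /mrestr setICl measure0.
rewrite setTD setCK; apply: eq_measure_integral => A mA AD.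
by rewrite /= /mrestr setIidl.
Qed.

End lower_integral.

(** * Lebesgue measure on R^d *)

Section lebesgue_cover.
Context (R : realType) (n : nat).
Local Notation d := n.+1.
Local Notation vec := 'rV[R]_d.
Local Notation leb := (@leb_outer R n).

Lemma box_volume_ge0 ab : 0 <= @box_volume R n ab.
Proof. by apply: prodr_ge0 => i _; rewrite le_max lexx. Qed.

Lemma leb_ge0 A : (0 <= leb A)%E.
Proof. exact: (outer_measure_ge0 leb). Qed.

Lemma le_leb (A B : set vec) : A `<=` B -> (leb A <= leb B)%E.
Proof. by move=> AB; exact: (le_outer_measure leb). Qed.

Lemma leb_cover A (I : nat -> vec * vec) : A `<=` \bigcup_k box (I k) ->
  (leb A <= \sum_(k <oo) (box_volume (I k))%:E)%E.
Proof. by move=> AI; apply: ereal_inf_lbound; exists I. Qed.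

Lemma leb_ge (A : set vec) (c : \bar R) :
  (forall I : nat -> vec * vec, A `<=` \bigcup_k box (I k) ->
     (c <= \sum_(k <oo) (box_volume (I k))%:E)%E) -> (c <= leb A)%E.
Proof. by move=> h; apply: le_ereal_inf_tmp => _ [I AI <-]; exact: h. Qed.

Lemma box_volume_diag x : @box_volume R n (x, x) = 0.
Proof. by rewrite /box_volume big_ord_recl /= subrr maxxx mul0r. Qed.

Lemma leb_box ab : (leb (box ab) <= (box_volume ab)%:E)%E.
Proof.
pose I k := if k is 0 then ab else (0, 0) : vec * vec.
apply: (@le_trans _ _ (\sum_(k <oo) (box_volume (I k))%:E)%E).
  by apply: leb_cover => x abx; exists 0.
rewrite nneseries_recl//; last by move=> k; rewrite lee_fin box_volume_ge0.
rewrite eseries0 ?adde0// => -[//|k] _ _.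
by rewrite box_volume_diag.
Qed.

(** The hyperplane [x_i = c] cuts each box of a cover into two boxes of the same half-open type.
    Their volumes add up exactly, since only the factor of index [i] changes, which gives
    Caratheodory's criterion. *)
Lemma measurable_halfspace (i : 'I_d) (c : R) :
  measurable ([set x : vec | x ord0 i <= c] : set (Rd R n)).
Proof.
apply: le_caratheodory_measurable => X; apply: leb_ge => I XI.
pose lo k := ((I k).1,
  \row_j if j == i then Num.min ((I k).2 ord0 j) c else (I k).2 ord0 j).
pose hi k := (\row_j (if j == i then Num.max ((I k).1 ord0 j) c
                      else (I k).1 ord0 j), (I k).2).
have -> : (\sum_(k <oo) (box_volume (I k))%:E = \sum_(k <oo)
    ((box_volume (lo k))%:E + (box_volume (hi k))%:E))%E.
  apply: eq_eseriesr => k _; rewrite -EFinD /box_volume.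
  pose V := \prod_(j < d | j != i) Num.max 0 ((I k).2 ord0 j - (I k).1 ord0 j).
  have -> : \prod_(j < d) Num.max 0 ((lo k).2 ord0 j - (lo k).1 ord0 j) =
      Num.max 0 (Num.min ((I k).2 ord0 i) c - (I k).1 ord0 i) * V.
    rewrite (bigD1 i)//= !mxE eqxx; congr (_ * _).
    by apply: eq_bigr => j /negPf ji; rewrite !mxE ji.
  have -> : \prod_(j < d) Num.max 0 ((hi k).2 ord0 j - (hi k).1 ord0 j) =
      Num.max 0 ((I k).2 ord0 i - Num.max ((I k).1 ord0 i) c) * V.
    rewrite (bigD1 i)//= !mxE eqxx; congr (_ * _).
    by apply: eq_bigr => j /negPf ji; rewrite !mxE ji.
  rewrite (bigD1 i)//= -mulrDl; congr (_ * _)%:E.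
  move: ((I k).1 ord0 i) ((I k).2 ord0 i) => a b.
  by case: (leP b c) => bc; case: (leP a c) => ac; rewrite /Num.max;
    do ![case: ifPn; rewrite -?leNgt => ?]; lra.
rewrite nneseriesD; last 2 first.
- by move=> k _ _; rewrite lee_fin box_volume_ge0.
- by move=> k _ _; rewrite lee_fin box_volume_ge0.
apply: leeD; apply: leb_cover => x [Xx /= xc].
- have [k _ /= Ikx] := XI _ Xx; exists k => // j; rewrite /= !mxE.
  have /andP[-> xb] := Ikx j => /=.
  by case: eqP => // ->; rewrite le_min xc andbT; have /andP[] := Ikx i.
- have [k _ /= Ikx] := XI _ Xx; exists k => // j; rewrite /= !mxE.
  have /andP[ax ->] := Ikx j; rewrite andbT.
  move/negP: xc; rewrite -ltNge => xc.
  by case: eqP => // ->; rewrite gt_max xc andbT; have /andP[] := Ikx i.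
Qed.

Lemma measurable_coord (i : 'I_d) :
  measurable_fun setT (fun x : Rd R n => (x : vec) ord0 i).
Proof.
apply: (measurability _ (RGenOInfty.measurableE R)) => // _ [_ [c ->] <-].
rewrite setTI (_ : _ @^-1` _ = ~` [set x : vec | x ord0 i <= c]).
  exact/measurableC/measurable_halfspace.
by apply/seteqP; split => x /=; rewrite in_itv/= andbT ltNge => /negP.
Qed.

Lemma measurable_box ab : measurable (box ab : set (Rd R n)).
Proof.
rewrite (_ : box ab = \bigcap_(i in setT)
    ((fun x : Rd R n => (x : vec) ord0 i) @^-1` `]ab.1 ord0 i, ab.2 ord0 i])).
  apply: fin_bigcap_measurable => // i _; rewrite -[X in measurable X]setTI.
  exact: measurable_coord.
apply/seteqP; split => x /= xab i; first by move=> _ /=; rewrite in_itv/=.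
by have := xab i I; rewrite /= in_itv.
Qed.

Lemma box_cover : \bigcup_k box (const_mx (- k%:R), const_mx k%:R) = [set: vec].
Proof.
apply/seteqP; split => // x _; exists (Num.truncn (\sum_i `|x ord0 i|)).+1 =>
  // i.
rewrite !mxE; set k := _.+1.
have : `|x ord0 i| < k%:R.
  apply: le_lt_trans (truncnS_gt _); rewrite (bigD1 i)//= lerDl.
  by apply: sumr_ge0 => j _.
by rewrite ltr_norml => /andP[-> /ltW].
Qed.

Lemma leb_sigma_finite : sigma_finite [set: Rd R n] (@lebesgue_Rd R n).
Proof.
exists (fun k : nat => box (const_mx (- k%:R), const_mx k%:R)).
  by rewrite box_cover.
by move=> k; split; [exact: measurable_box|exact: le_lt_trans (leb_box _) (ltry
  _)].
Qed.

HB.instance Definition _ := Measure_isSigmaFinite.Build _ (Rd R n) R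
  (@lebesgue_Rd R n) leb_sigma_finite.

(** The inverse homothety turns a cover of the copy into a cover of [A], with volumes divided by
    [rho ^ d]. The opposite inequality is this one for the inverse homothety. *)
Lemma leb_homothet_ge rho x A : 0 < rho ->
  ((rho ^+ d)%:E * leb A <= leb (homothet rho x A))%E.
Proof.
move=> r0; apply: leb_ge => I AI.
have rd0 : 0 < rho ^+ d by rewrite exprn_gt0.
rewrite -lee_pdivlMl//.
pose J k := (rho^-1 *: ((I k).1 - x), rho^-1 *: ((I k).2 - x)).
apply: (@le_trans _ _ (\sum_(k <oo) (box_volume (J k))%:E)%E).
  apply: leb_cover => y Ay; have [|k _ /= Iky] := AI (rho *: y + x);
    first by exists y.
  exists k => // i; have := Iky i; rewrite /= !mxE.
  by rewrite ltr_pdivrMl// ler_pdivlMl// ltrBlDr lerBrDr.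
rewrite -nneseriesZl; last by move=> k _; rewrite lee_fin box_volume_ge0.
apply: lee_nneseries => [k _|k _]; first by rewrite lee_fin box_volume_ge0.
rewrite -EFinM lee_fin /box_volume.
rewrite -exprVn -[X in _ ^+ X]card_ord -prodr_const -big_split/=.
apply: ler_prod => i _; rewrite le_max lexx/= !mxE -mulrBr opprB addrA subrK.
by rewrite maxr_pMr ?invr_ge0 ?(ltW r0)// mulr0.
Qed.

Lemma homothetK rho x A : rho != 0 ->
  homothet rho^-1 (- (rho^-1 *: x)) (homothet rho x A) = A :> set vec.
Proof.
move=> r0; have K (y : vec) : rho^-1 *: (rho *: y + x) - rho^-1 *: x = y.
  by rewrite scalerDr scalerK// addrK.
apply/seteqP; split => [_ [_ [y Ay <-] <-]|y Ay]; first by rewrite K.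
by exists (rho *: y + x); [exists y|rewrite K].
Qed.

Lemma leb_homothet rho x A : 0 < rho ->
  leb (homothet rho x A) = ((rho ^+ d)%:E * leb A)%E.
Proof.
move=> r0; apply/eqP; rewrite eq_le leb_homothet_ge// andbT.
have rV0 : 0 < rho^-1 by rewrite invr_gt0.
have := @leb_homothet_ge _ (- (rho^-1 *: x)) (homothet rho x A) rV0.
rewrite homothetK ?gt_eqF// => h.
by rewrite -lee_pdivrMl ?exprn_gt0// -exprVn.
Qed.

(** Boxes are open on the left, so the reflection of []a, b]] is not of the same type. It is
    enlarged to []-b - (b - a), -a]], of twice the length in each direction, whence the factor
    [2 ^ d]. *)
Lemma leb_opp A : (leb [set x : vec | A (- x)%R] <= (2 ^+ d)%:E * leb A)%E.
Proof.
rewrite -lee_pdivrMl ?exprn_gt0//; apply: leb_ge => I AI.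
rewrite lee_pdivrMl ?exprn_gt0//.
pose J k := (- (I k).2 - ((I k).2 - (I k).1), - (I k).1).
apply: (@le_trans _ _ (\sum_(k <oo) (box_volume (J k))%:E)%E).
  apply: leb_cover => y /AI[k _ /= Iky]; exists k => // i.
  by have /andP[] := Iky i; rewrite /= !mxE; lra.
rewrite -nneseriesZl; last by move=> k _; rewrite lee_fin box_volume_ge0.
apply: lee_nneseries => [k _|k _]; first by rewrite lee_fin box_volume_ge0.
rewrite -EFinM lee_fin /box_volume -[X in 2 ^+ X]card_ord -prodr_const
  -big_split/=.
apply: ler_prod => i _; rewrite le_max lexx/= !mxE /Num.max.
by do ![case: ifPn; rewrite -?leNgt => ?]; lra.
Qed.

Lemma leb_bigcup0 (A : nat -> set vec) :
  (forall k, leb (A k) = 0%E) -> leb (\bigcup_k A k) = 0%E.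
Proof.
move=> A0; apply/eqP; rewrite eq_le leb_ge0 andbT.
apply: (le_trans (outer_measure_sigma_subadditive leb A)).
by rewrite eseries0// => k _ _; exact: A0.
Qed.

Lemma leb_hyperplane i c : leb [set x : vec | x ord0 i = c] = 0%E.
Proof.
pose B k : set vec := [set x : vec | x ord0 i = c] `&` box (const_mx (- k%:R),
  const_mx k%:R).
have -> : [set x : vec | x ord0 i = c] = \bigcup_k B k.
  by rewrite -setI_bigcupr box_cover setIT.
apply: leb_bigcup0 => k; apply/eqP; rewrite eq_le leb_ge0 andbT.
apply/lee_addgt0Pr => e e0; rewrite add0e.
pose V := (k%:R - - k%:R : R) ^+ n.
have V0 : 0 <= V by apply: exprn_ge0; rewrite opprK addr_ge0.
(* The thickness that makes the volume [del * V] at most [e]; the [+ 1] covers [V = 0], which occurs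
   for [k = 0] when [n > 0]. *)
pose del := e / (V + 1).
have del0 : 0 < del by rewrite divr_gt0// ltr_pwDr.
pose ab := (\row_j (if j == i then c - del else - k%:R),
  \row_j (if j == i then c else k%:R)) : vec * vec.
apply: (@le_trans _ _ (leb (box ab))).
  apply: le_leb => x [/= xi xB] j; have := xB j; rewrite !mxE.
  by case: eqP => // -> _; rewrite xi lexx ltrBlDr ltrDl del0.
apply: (le_trans (leb_box ab));
  rewrite lee_fin /box_volume (bigD1 i)//= !mxE eqxx.
rewrite (eq_bigr (fun=> k%:R - - k%:R)); last first.
  move=> j /negPf ji; rewrite !mxE ji max_r// opprK addr_ge0.
rewrite prodr_const cardC1 card_ord -/V subKr max_r ?(ltW del0)//.
by rewrite /del mulrAC ler_pdivrMr ?ltr_pwDr// ler_pM2l// lerDl.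
Qed.

(* Fubini without product measures: integrating a pointwise bound on the sum of
   the indicators of the boxes one coordinate at a time. *)
Lemma le_sum_box_volume (u : nat -> R) (a b : nat -> nat -> R) (j : nat) :
  (forall i, 0 <= u i) ->
  forall (w : R) (c : nat -> R), 0 <= w -> (forall k, 0 <= c k) ->
  (forall x : nat -> R, (forall i, (i < j)%N -> 0 < x i < u i) ->
    (w%:E <= \sum_(k <oo)
      (c k * \prod_(i < j) (a k i < x i <= b k i)%R%:R)%:E)%E) ->
  ((w * \prod_(i < j) u i)%:E <=
    \sum_(k <oo) (c k * \prod_(i < j) Num.max 0 (b k i - a k i))%:E)%E.
Proof.
move=> u0; elim: j => [|j IH] w c w0 c0 h.
  rewrite big_ord0; have := h (fun=> 0) (fun i => ltac:(by [])).
  rewrite mulr1 => /le_trans; apply; apply: lee_nneseries => k _.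
    by rewrite lee_fin !big_ord0 mulr1.
  by rewrite !big_ord0.
rewrite (_ : w * _ = (w * u j) * \prod_(i < j) u i); last first.
  by rewrite big_ord_recr/=; ring.
rewrite [leRHS](_ : _ = \sum_(k <oo) ((c k * Num.max 0 (b k j - a k j)) *
    \prod_(i < j) Num.max 0 (b k i - a k i))%:E)%E; last first.
  by apply: eq_eseriesr => k _; rewrite big_ord_recr/= mulrA mulrAC.
(* Coordinate [j] is integrated out: its side [u j] joins the weight [w], and the length of the
   [k]-th interval joins [c k]. *)
apply: IH => [|k|x xu]; first exact: mulr_ge0.
  by rewrite mulr_ge0// le_max lexx.
pose m : {measure set (measurableTypeR R) -> \bar R} := @lebesgue_measure R.
pose P k := \prod_(i < j) (a k i < x i <= b k i)%R%:R : R.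
have P0 k : 0 <= P k by apply: prodr_ge0 => i _; rewrite ler0n.
pose f k (t : R) := (c k * P k * (a k j < t <= b k j)%R%:R)%:E.
have f0 k t : (0 <= f k t)%E by rewrite lee_fin !mulr_ge0.
have fE k t : f k t = ((c k * P k)%:E * (\1_(`]a k j, b k j] : set R) t)%:E)%E.
  rewrite -EFinM indicE mem_setE; congr (_ * _%:R)%:E.
have mI k : measurable_fun [set: measurableTypeR R]
    (fun t => (\1_(`]a k j, b k j] : set R) t)%:E).
  by apply/measurable_EFinP; apply: measurable_indic; exact: measurable_itv.
have mf k : measurable_fun [set: measurableTypeR R] (f k).
  by rewrite (funext (fE k)); apply: measurable_funeM; exact: mI.
apply: (@le_trans _ _ (\int[m]_(t in `]0%R, u j[) (\sum_(k <oo) f k t))%E).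
  rewrite -(_ : \int[m]_(t in `]0%R, u j[) (cst w%:E) t = (w * u j)%:E)%E.
    apply: (@ge0_le_integral_in _ _ R m `]0%R, u j[%classic (cst w%:E)) =>
      t /=; rewrite ?lee_fin//.
    rewrite in_itv/= => tu.
    have := h (fun i => if (i < j)%N then x i else t); move/(_ _)/le_trans;
      apply.
      move=> i; rewrite ltnS leq_eqVlt => /predU1P[->|ij];
        first by rewrite ltnn.
      by rewrite ij xu.
    apply: lee_nneseries => k _; first by rewrite lee_fin mulr_ge0// prodr_ge0.
    rewrite big_ord_recr/= ltnn mulrA lee_fin /P.
    by under eq_bigr => i _ do rewrite ltn_ord.
  rewrite integral_cst// /m/= lebesgue_measure_itv/= lte_fin.
  by have := u0 j; rewrite le_eqVlt => /predU1P[<-|->];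
    rewrite ?ltxx ?mule0 ?mulr0// sube0.
rewrite integral_nneseries//; last by move=> k; exact: measurable_funS (mf k).
apply: lee_nneseries => k _; first by move=> _; apply: integral_ge0 => t _;
  exact: f0.
rewrite -/(P k) (_ : _ * _ = (c k * P k) * Num.max 0 (b k j - a k j));
  last by ring.
apply: (@le_trans _ _ (\int[m]_t f k t)%E).
  by apply: ge0_subset_integral => //.
under eq_integral do rewrite fE.
rewrite ge0_integralZl//; last by rewrite lee_fin mulr_ge0.
rewrite integral_indic// setIT [leRHS]EFinM; apply: lee_wpmul2l.
  by rewrite lee_fin mulr_ge0.
rewrite /m/= lebesgue_measure_itv/= lte_fin.
by case: ifPn; rewrite -?EFinD lee_fin le_max lexx ?orbT.
Qed.

(** Each point of the open box lies in some box of any cover, so the sum of the indicators is at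
    least 1 there. This is the hypothesis of [le_sum_box_volume] with unit weights. *)
Lemma leb_open_box (u : nat -> R) : (forall i, 0 <= u i) ->
  ((\prod_(i < d) u i)%:E <=
    leb [set x : vec | forall i, (0 < x ord0 i < u i)%R])%E.
Proof.
move=> u0; apply: leb_ge => I uI.
pose a k i := (I k).1 ord0 (inord i).
pose b k i := (I k).2 ord0 (inord i).
have := @le_sum_box_volume u a b d u0 1 (fun=> 1) ler01 (fun=> ler01).
rewrite mul1r => /(_ _)/le_trans; apply; last first.
  apply: lee_nneseries => k _.
    by rewrite lee_fin mul1r prodr_ge0// => i _; rewrite le_max lexx.
  rewrite lee_fin mul1r /box_volume le_eqVlt; apply/orP; left; apply/eqP.
  by apply: eq_bigr => i _; rewrite /a /b inord_val.
move=> x xu; have [|k _ /= Ik] := uI (\row_i x i).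
  by move=> i; rewrite mxE; exact: xu.
apply: le_trans (nneseries_lim_ge k.+1 _); last first.
  by move=> l _ _; rewrite lee_fin mul1r prodr_ge0.
rewrite big_mkord big_ord_recr/= -[leLHS]add0e; apply: leeD.
  by apply: sume_ge0 => l _; rewrite lee_fin mul1r prodr_ge0.
rewrite mul1r big1// => i _; have := Ik i.
by rewrite mxE /a /b inord_val => ->.
Qed.

Lemma leb_unit_cube : (1 <= leb [set x :
  vec | forall i, (0 < x ord0 i < 1)%R])%E.
Proof.
have := @leb_open_box (fun=> 1) (fun=> ler01).
by rewrite prodr_const expr1n.
Qed.

Lemma leb_countable_slices (i : 'I_d) (S : set R) : countable S ->
  leb [set x : vec | S (x ord0 i)] = 0%E.
Proof.
move=> cS; have [s Ss] := @pcard_surjP R nat S [set: nat] cS.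
apply/eqP; rewrite eq_le leb_ge0 andbT.
apply: (@le_trans _ _ (leb (\bigcup_k [set x : vec | x ord0 i = s k]))).
  by apply: le_leb => x /= /Ss[k _ sk]; exists k.
by rewrite leb_bigcup0// => k; exact: leb_hyperplane.
Qed.

End lebesgue_cover.

(** * Dyadic discretization of the integrals in r *)

Section dyadic.
Context (R : realType).

(** The preimage of an upward ray is closed upwards, hence an interval. Monotonicity thus supplies
    measurability in the width [r]. *)
Lemma nondecreasing_emeasurable (phi : R -> \bar R) :
  {homo phi : r s / r <= s >-> (r <= s)%E} ->
  measurable_fun [set: measurableTypeR R] phi.
Proof.
move=> nd; apply: (measurability _ (ErealGenOInfty.measurableE R)) => //.
move=> _ [_ [y ->] <-]; rewrite setTI; apply: is_interval_measurable.
move=> r s /=; rewrite !in_itv/= !andbT => yr _ t /andP[rt _].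
by rewrite /= in_itv/= andbT; exact: lt_le_trans yr (nd _ _ rt).
Qed.

Lemma measurable_invr : measurable_fun [set: measurableTypeR R] (@GRing.inv R).
Proof.
rewrite -(setUv [set (0 : R)]); apply/measurable_funU => //.
  exact: measurableC.
split; first exact: measurable_fun_set1.
apply: open_continuous_measurable_fun.
  by apply: closed_openC; exact: closed_eq.
by move=> x; rewrite inE/= => /eqP x0; exact: inv_continuous.
Qed.

Lemma exists_half_pow_le (r : R) : 0 < r -> exists m, 2^-1 ^+ m <= r.
Proof.
move=> r0.
have [N _ /(_ N (leqnn N))] : \forall m \near \oo, `|0 - 2^-1 ^+ m : R| < r.
  by apply: (cvgr_dist_lt _ _); [apply: cvg_expr; rewrite ger0_norm; lra|].
rewrite /= sub0r normrN => h; exists N; apply/ltW.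
by apply: le_lt_trans h; exact: ler_norm.
Qed.

Let I (k : nat) : set R := `[2^-1 ^+ k.+1, 2^-1 ^+ k[.

Let half_itv (r : R) : 0 < r < 1 -> exists k, I k r.
Proof.
move=> /andP[r0 r1]; have ex := exists_half_pow_le r0.
case: (ex_minnP ex) => [[|k] kr kmin]; first by move: r1; rewrite ltNge kr.
exists k; rewrite /I /= in_itv/= kr/= ltNge; apply/negP => /kmin.
by rewrite ltnn.
Qed.

Let pow_le j k : (j <= k)%N -> 2^-1 ^+ k <= 2^-1 ^+ j :> R.
Proof. by move=> jk; apply: ler_wiXn2l => //; lra. Qed.

Let bigcup_half_itv : \bigcup_k I k = `]0, 1[%classic.
Proof.
apply/seteqP; split => [r [k _]|r]; rewrite /I /= !in_itv/=; last first.
  by move=> /half_itv[k Ik]; exists k.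
move=> /andP[kr rk]; rewrite (lt_le_trans _ kr) ?exprn_gt0//=.
by rewrite (lt_le_trans rk)// (@pow_le 0).
Qed.

Let trivIset_half_itv : trivIset setT I.
Proof.
apply/trivIsetP => j k _ _; wlog jk : j k / (j < k)%N.
  by move=> h; rewrite neq_lt => /orP[jk|jk];
    [|rewrite setIC]; apply: h => //; rewrite neq_lt jk.
move=> _; apply/seteqP; split => // r []; rewrite /I /= !in_itv/=.
move=> /andP[jr _] /andP[_ rk].
by have := lt_le_trans rk (le_trans (pow_le jk) jr); rewrite ltxx.
Qed.

Let measure_half_itv k : lebesgue_measure (I k) = (2^-1 ^+ k.+1)%:E.
Proof.
rewrite lebesgue_measure_itv/= lte_fin exprS gtr_pMl ?exprn_gt0//.
rewrite ifT; last lra.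
by rewrite -EFinD; congr (_%:E); lra.
Qed.

Section comparison.
Variable phi : R -> \bar R.
Hypothesis phi0 : forall r, (0 <= phi r)%E.
Hypothesis phi_nd : {homo phi : r s / r <= s >-> (r <= s)%E}.

Let integral_dyadic :
  (\int[lebesgue_measure]_(r in `]0%R, 1%R[) (r^-1%:E * phi r) =
   \sum_(k <oo) \int[lebesgue_measure]_(r in I k) (r^-1%:E * phi r))%E.
Proof.
rewrite -bigcup_half_itv; apply: ge0_integral_bigcup => //.
- by move=> k; exact: measurable_itv.
- rewrite bigcup_half_itv; apply: emeasurable_funM.
  + apply/measurable_EFinP; apply: measurable_funTS.
    exact: measurable_invr.
  + by apply: measurable_funTS; exact: nondecreasing_emeasurable.
- move=> r; rewrite bigcup_half_itv/= in_itv/= => /andP[r0 _].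
  by rewrite mule_ge0// lee_fin invr_ge0 ltW.
Qed.

Let cstI c k : (0 <= c)%E ->
  (\int[lebesgue_measure]_(r in I k) cst ((2 ^+ k.+1)%:E * c) r = c)%E.
Proof.
move=> c0; rewrite integral_cst; last exact: measurable_itv.
rewrite [X in (_ * X)%E](_ : _ = (2^-1 ^+ k.+1)%:E);
  last exact: measure_half_itv.
rewrite muleAC -EFinM -exprMn.
by rewrite divff// expr1n mul1e.
Qed.

(** On [I k] the factor [1 / r] is at most [2 ^ (k + 1)], the inverse of the length of [I k], and
    [phi] is at most its value at the right end. Each piece thus contributes at most
    [phi (2^-k)]. *)
Lemma dyadic_ge : (\int[lebesgue_measure]_(r in `]0%R,
  1%R[) (r^-1%:E * phi r) <=
  \sum_(k <oo) phi (2^-1 ^+ k))%E.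
Proof.
rewrite integral_dyadic; apply: lee_nneseries => k _.
  move=> _; apply: integral_ge0 => r; rewrite /I /= in_itv/= => /andP[kr _].
  by rewrite mule_ge0// lee_fin invr_ge0 (le_trans _ kr)// exprn_ge0.
rewrite -[leRHS](@cstI _ k)//; apply: ge0_le_integral_in => r;
  rewrite /I /= in_itv/= => /andP[kr rk];
  have r0 : 0 < r by rewrite (lt_le_trans _ kr)// exprn_gt0.
- by rewrite mule_ge0// lee_fin invr_ge0 ltW.
- apply: lee_pmul => //; first by rewrite lee_fin invr_ge0 ltW.
  + by rewrite lee_fin -[leRHS]invrK lef_pV2 ?posrE ?invr_gt0 ?exprn_gt0//
    -exprVn.
  + exact/phi_nd/ltW.
Qed.

(** On [I k] the factor [1 / r] is at least [2 ^ k], half the inverse of the length: this is the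
    constant [2^-1]. The value of [phi] is taken at the left end, hence the shifted index. *)
Lemma dyadic_le : (2^-1%:E * \sum_(k <oo) phi (2^-1 ^+ k.+1) <=
  \int[lebesgue_measure]_(r in `]0%R, 1%R[) (r^-1%:E * phi r))%E.
Proof.
rewrite integral_dyadic -nneseriesZl//; apply: lee_nneseries => k _.
  by move=> _; rewrite mule_ge0.
rewrite -[leLHS](@cstI _ k) ?mule_ge0//; apply: ge0_le_integral_in => r;
  rewrite /I /= in_itv/= => /andP[kr rk].
  by rewrite !mule_ge0// lee_fin exprn_ge0.
have r0 : 0 < r by rewrite (lt_le_trans _ kr)// exprn_gt0.
rewrite muleA -EFinM; apply: lee_pmul => //.
- rewrite lee_fin exprS mulrAC divff// mul1r.
  by rewrite -[leLHS]invrK lef_pV2 ?posrE ?invr_gt0 ?exprn_gt0// -exprVn ltW.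
- exact: phi_nd.
Qed.

End comparison.

End dyadic.

(** * Homotheties, boundaries and parallel sets *)

Section geometry.
Context (R : realType) (n : nat).
Local Notation d := n.+1.
Local Notation vec := 'rV[R]_d.
Local Notation leb := (@leb_outer R n).
Implicit Types (rho r : R) (x y : vec) (A B H G : set vec).

Lemma euclid_normZ rho x : 0 <= rho ->
  euclid_norm (rho *: x) = rho * euclid_norm x.
Proof.
move=> r0; rewrite /euclid_norm -[X in X * _](ger0_norm r0) -sqrtr_sqr -sqrtrM
  ?sqr_ge0//.
by congr Num.sqrt; rewrite mulr_sumr; apply: eq_bigr => i _; rewrite mxE exprMn.
Qed.

Lemma norm_coord_le x i : `|x ord0 i| <= euclid_norm x.
Proof.
rewrite -sqrtr_sqr; apply: ler_wsqrtr; rewrite (bigD1 i)//= lerDl.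
by apply: sumr_ge0 => j _; exact: sqr_ge0.
Qed.

Lemma dist_lt x A r :
  (dist x A < r%:E)%E <-> exists2 y, A y & euclid_norm (x - y) < r.
Proof.
split=> [/ereal_inf_lt[_ [y Ay <-]]|[y Ay xyr]].
  by rewrite lte_fin; exists y.
by apply: le_lt_trans (_ : _ <= (euclid_norm (x - y))%:E)%E _;
  rewrite ?lte_fin//;
  apply: ereal_inf_lbound; exists y.
Qed.

Lemma inner_collarE G r :
  inner_collar G r = G `&` outer_parallel (boundary G) r.
Proof. by []. Qed.

Lemma inner_parallelE H r :
  inner_parallel H r = H `\` outer_parallel (boundary H) r.
Proof.
by apply/seteqP; split => x [Hx]; rewrite /outer_parallel /= => Hr; split=> //;
  [apply/negP; rewrite -leNgt|rewrite leNgt; exact/negP].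
Qed.

Section homothety.
Context (rho : R) (x : vec).
Hypothesis r0 : 0 < rho.

Let r_neq0 : rho != 0. Proof. by rewrite gt_eqF. Qed.

Lemma homothetE A : homothet rho x A = [set y | A (rho^-1 *: (y - x))].
Proof.
apply/seteqP; split => [_ [y Ay <-]/=|y Ay]; first by rewrite addrK scalerK.
by exists (rho^-1 *: (y - x)) => //; rewrite scalerA divff// scale1r subrK.
Qed.

Lemma homothetVK A :
  homothet rho x (homothet rho^-1 (- (rho^-1 *: x)) A) = A.
Proof.
have K (y : vec) : rho *: (rho^-1 *: y - rho^-1 *: x) + x = y.
  by rewrite -scalerBr scalerA divff// scale1r subrK.
apply/seteqP; split => [_ [_ [y Ay <-] <-]|y Ay]; first by rewrite K.
by exists (rho^-1 *: y - rho^-1 *: x); [exists y|rewrite K].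
Qed.

Lemma homothet_mono A B : A `<=` B -> homothet rho x A `<=` homothet rho x B.
Proof. exact: image_subset. Qed.

Lemma homothetC A : homothet rho x (~` A) = ~` homothet rho x A.
Proof. by rewrite !homothetE. Qed.

Lemma homothetI A B :
  homothet rho x (A `&` B) = homothet rho x A `&` homothet rho x B.
Proof. by rewrite !homothetE. Qed.

Lemma homothetD A B :
  homothet rho x (A `\` B) = homothet rho x A `\` homothet rho x B.
Proof. by rewrite !homothetE. Qed.

End homothety.

Lemma homothet_continuous rho x : continuous (fun y : vec => rho *: y + x).
Proof.
move=> y; have h : {for y, continuous (fun z : vec => rho *: z)}.
  exact: scaler_continuous.
exact: (@cvgD _ _ _ (nbhs y) _ (fun z : vec => rho *: z) (fun=> x) _ _ h
  (@cvg_cst _ _ _ _ _)).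
Qed.

(** The right-hand side contains the copy of [A] and is closed, being the preimage of [closure A]
    under the inverse homothety. *)
Lemma closure_homothet_sub rho x A : 0 < rho ->
  closure (homothet rho x A) `<=` homothet rho x (closure A).
Proof.
move=> r0; rewrite closureE; apply: smallest_sub; last first.
  exact/homothet_mono/subset_closure.
have -> : homothet rho x (closure A) =
    (fun y : vec => rho^-1 *: y + - (rho^-1 *: x)) @^-1` closure A.
  rewrite (homothetE x r0); congr mkset; apply/funext => y; congr (closure A _).
  exact: scalerBr.
pose f y : vec := rho^-1 *: y + - (rho^-1 *: x).
apply: (@preimage_closed _ _ f (closure A)); last exact: closed_closure.
by move=> y _; exact: (homothet_continuous (rho := rho^-1)).
Qed.

Lemma closure_homothet rho x A : 0 < rho ->
  closure (homothet rho x A) = homothet rho x (closure A).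
Proof.
move=> r0; apply/seteqP; split; first exact: closure_homothet_sub.
have rV0 : 0 < rho^-1 by rewrite invr_gt0.
have := @closure_homothet_sub _ (- (rho^-1 *: x)) (homothet rho x A) rV0.
rewrite homothetK ?gt_eqF// => /(homothet_mono (rho := rho) (x := x)).
by rewrite homothetVK.
Qed.

Lemma boundaryE A : boundary A = closure A `&` closure (~` A).
Proof. by rewrite /boundary -[X in interior X]setCK interiorC setDE setCK. Qed.

Lemma boundary_homothet rho x A : 0 < rho ->
  boundary (homothet rho x A) = homothet rho x (boundary A).
Proof.
by move=> r0; rewrite !boundaryE -homothetC// !closure_homothet// homothetI.
Qed.

Lemma compact_homothet rho x A : 0 < rho ->
  compact (homothet rho x A) <-> compact A.
Proof.
have sub s z B : 0 < s -> compact B -> compact (homothet s z B).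
  move=> s0 cB; apply: (@continuous_compact _ _ (fun y => s *: y + z)) => //.
  exact/continuous_subspaceT/homothet_continuous.
move=> r0; split; last exact: sub.
move=> /(@sub rho^-1 (- (rho^-1 *: x))).
by rewrite homothetK ?gt_eqF// invr_gt0; exact.
Qed.

Lemma diam_ge0 A : (0 <= diam A)%E.
Proof. by apply: ereal_sup_ubound; left. Qed.

Lemma le_diam A x y : A x -> A y -> ((euclid_norm (x - y))%:E <= diam A)%E.
Proof. by move=> Ax Ay; apply: ereal_sup_ubound; right; exists x => //;
  exists y. Qed.

Lemma diam_homothet rho x A : 0 < rho ->
  diam (homothet rho x A) = (rho%:E * diam A)%E.
Proof.
have sub s z B : 0 < s -> (diam (homothet s z B) <= s%:E * diam B)%E.
  move=> s0; apply: ge_ereal_sup => t [->|].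
    by rewrite mule_ge0 ?diam_ge0// lee_fin ltW.
  move=> [w [u Bu <-] [w' [v Bv <-] <-]].
  rewrite opprD addrACA subrr addr0 -scalerBr euclid_normZ ?(ltW s0)// EFinM.
  by apply: lee_wpmul2l; [rewrite lee_fin ltW|exact: le_diam].
move=> r0; apply/eqP; rewrite eq_le sub//=.
have rV0 : 0 < rho^-1 by rewrite invr_gt0.
have := @sub rho^-1 (- (rho^-1 *: x)) (homothet rho x A) rV0.
by rewrite homothetK ?gt_eqF// lee_pdivlMl.
Qed.

Lemma outer_parallel_homothet rho x A r : 0 < rho ->
  outer_parallel (homothet rho x A) r =
  homothet rho x (outer_parallel A (rho^-1 * r)).
Proof.
move=> r0; rewrite [RHS]homothetE//; apply/seteqP; split => y /= /dist_lt[z].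
  move=> [u Au <-] yu; apply/dist_lt; exists u => //.
  rewrite ltr_pdivlMl// -euclid_normZ ?(ltW r0)// scalerBr scalerA divff
    ?gt_eqF//.
  by rewrite scale1r -addrA -opprD [x + _]addrC.
move=> Az; rewrite ltr_pdivlMl// -euclid_normZ ?(ltW r0)// scalerBr scalerA
  divff ?gt_eqF//.
rewrite scale1r -addrA -opprD [x + _]addrC => yz.
by apply/dist_lt; exists (rho *: z + x) => //; exists z.
Qed.

Lemma leb_inner_collar_homothet rho x A r : 0 < rho ->
  leb (inner_collar (homothet rho x A) r) =
  ((rho ^+ d)%:E * leb (inner_collar A (rho^-1 * r)))%E.
Proof.
move=> r0; rewrite !inner_collarE boundary_homothet// outer_parallel_homothet//.
by rewrite -homothetI// leb_homothet.
Qed.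

Lemma leb_parallel_homothet rho x A r : 0 < rho ->
  leb (outer_parallel (homothet rho x A) r `\`
       inner_parallel (homothet rho x A) r) =
  ((rho ^+ d)%:E *
   leb (outer_parallel A (rho^-1 * r) `\` inner_parallel A (rho^-1 * r)))%E.
Proof.
move=> r0; rewrite !inner_parallelE boundary_homothet//
  !outer_parallel_homothet//.
by rewrite -!homothetD// leb_homothet.
Qed.

Lemma outer_parallel_mono A r s : r <= s ->
  outer_parallel A r `<=` outer_parallel A s.
Proof. by move=> rs x /= /lt_le_trans; apply; rewrite lee_fin. Qed.

Lemma inner_collar_mono G r s : r <= s ->
  inner_collar G r `<=` inner_collar G s.
Proof. by move=> rs; rewrite !inner_collarE; apply: setIS;
  exact: outer_parallel_mono. Qed.

Lemma parallel_mono H r s : r <= s ->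
  outer_parallel H r `\` inner_parallel H r `<=`
  outer_parallel H s `\` inner_parallel H s.
Proof.
move=> rs x; rewrite !inner_parallelE => -[Hr Nr]; split.
  exact: outer_parallel_mono Hr.
by move=> [Hx Ns]; apply: Nr; split => // /(outer_parallel_mono rs).
Qed.

Lemma subset_outer_parallel A r : 0 < r -> closure A `<=` outer_parallel A r.
Proof.
(* Neighbourhoods are balls of the maximum norm. With radius [r / d] in that norm, the squared
   Euclidean distance is below [d * (r / d) ^ 2 <= r ^ 2]. *)
move=> r0 x clA; have e0 : 0 < r / d%:R by rewrite divr_gt0.
have [y [Ay [_ xy]]] := clA _ (nbhsx_ballx x _ e0).
apply/dist_lt; exists y => //.
rewrite /euclid_norm -[ltRHS]gtr0_norm// -sqrtr_sqr ltr_sqrt ?exprn_gt0//.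
apply: (@lt_le_trans _ _ (\sum_(i < d) (r / d%:R) ^+ 2)).
  apply: ltr_sum => [|i _]; first by apply/hasP; exists ord0;
    rewrite ?mem_index_enum.
  have := xy ord0 i; rewrite /ball/= !mxE => h.
  rewrite -real_normK ?num_real//.
  by rewrite ltr_pXn2r// nnegrE ltW.
rewrite sumr_const card_ord -[leLHS]mulr_natr exprMn -mulrA ler_piMr ?sqr_ge0//.
by rewrite expr2 -mulrA mulVf ?pnatr_eq0// mulr1 invf_le1 ?ler1n.
Qed.

Lemma inner_collar_parallel H r : 0 < r ->
  inner_collar H r `<=` outer_parallel H r `\` inner_parallel H r.
Proof.
move=> r0 x [Hx xr]; split; last by rewrite inner_parallelE => -[].
exact/subset_outer_parallel/subset_closure.
Qed.

Lemma boundary_parallel H r : 0 < r ->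
  boundary H `<=` outer_parallel H r `\` inner_parallel H r.
Proof.
move=> r0 x Hx; split; first by case: Hx => Hx _; exact: subset_outer_parallel.
rewrite inner_parallelE => -[_]; apply.
exact/subset_outer_parallel/subset_closure.
Qed.

Lemma boundary_inner_collar G r : compact G -> 0 < r ->
  boundary G `<=` inner_collar G r.
Proof.
move=> cG r0 x Gx; split; last exact/subset_outer_parallel/subset_closure.
case: Gx => + _; have : closed G by apply: compact_closed => //;
  exact: norm_hausdorff.
by move=> /closure_id <-.
Qed.

Lemma leb_diam_le1 A : (diam A <= 1)%E -> (leb A <= (4 ^+ d)%:E)%E.
Proof.
move=> dA; have [->|/set0P[a Aa]] := eqVneq A set0.
  by rewrite (outer_measure0 leb) lee_fin exprn_ge0.
(* Half-width 2 instead of 1 leaves room for the strict inequality on the left side of a box; it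
   gives the constant [4 ^ d]. *)
have := leb_box (a - const_mx 2, a + const_mx 2).
rewrite /box_volume/= (eq_bigr (fun=> 4)); last first.
  by move=> i _; rewrite !mxE max_r; lra.
rewrite prodr_const card_ord; apply: le_trans; apply: le_leb => x Ax i.
have := norm_coord_le (x - a) i; have : euclid_norm (x - a) <= 1.
  by rewrite -lee_fin; exact: le_trans (le_diam Ax Aa) dA.
by move=> /[swap] /le_trans h /h; rewrite ler_norml !mxE/=; lra.
Qed.

(** The translations in question form the reflection of [rho A]; the factor [2 ^ d] is the loss in
    [leb_opp]. *)
Lemma leb_origin_le rho A : 0 < rho ->
  (leb [set x : vec | homothet rho x A 0%R] <=
    (2 ^+ d * rho ^+ d)%:E * leb A)%E.
Proof.
move=> r0; rewrite (_ : [set x | _] = [set x | homothet rho 0 A (- x)]).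
  by rewrite (le_trans (leb_opp _))// leb_homothet// muleA.
by apply/seteqP; split => x /=; rewrite !homothetE//= sub0r subr0.
Qed.

(** Reflection is an involution, so [leb_opp] also bounds [rho A] by the set of translations. If
    these form a null set, [A] is null. *)
Lemma leb_origin_ge rho A : 0 < rho ->
  ((rho ^+ d)%:E * leb A <=
   (2 ^+ d)%:E * leb [set x : vec | homothet rho x A 0%R])%E.
Proof.
move=> r0; rewrite -(leb_homothet 0)//.
apply: le_trans (leb_opp _); apply: le_leb => x /=.
by rewrite !homothetE//= sub0r subr0 opprK.
Qed.

End geometry.

(** * Scale invariant measures *)

Section triple_tonelli.
Local Open Scope ereal_scope.
Context d1 d2 d3 (T1 : measurableType d1) (T2 : measurableType d2)
  (T3 : measurableType d3) (R : realType).
Variables (m1 : {sigma_finite_measure set T1 -> \bar R})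
  (m2 : {sigma_finite_measure set T2 -> \bar R})
  (m3 : {sigma_finite_measure set T3 -> \bar R}).
Variable g : T1 * T2 * T3 -> \bar R.
Hypothesis mg : measurable_fun setT g.
Hypothesis g0 : forall p, 0 <= g p.

Lemma measurable_integral_fst :
  measurable_fun setT (fun q : T2 * T3 => \int[m1]_a g (a, q.1, q.2)).
Proof.
pose g' (p : T1 * (T2 * T3)) := g (p.1, p.2.1, p.2.2).
have mg' : measurable_fun setT g'.
  apply: (measurableT_comp mg); apply: measurable_fun_pair.
    apply: measurable_fun_pair; first exact: measurable_fst.
    by apply: (measurableT_comp measurable_fst); exact: measurable_snd.
  by apply: (measurableT_comp measurable_snd); exact: measurable_snd.
exact: (measurable_fun_fubini_tonelli_G (m1 := m1) g' mg' (fun p => g0 _)).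
Qed.

Lemma measurable_triple_integral : measurable_fun setT
  (fun b => \int[m1]_a \int[m3]_c g (a, b, c)).
Proof.
have mJ : measurable_fun setT (fun q => \int[m3]_c g (q, c)).
  exact: (measurable_fun_fubini_tonelli_F (m2 := m3) g).
apply: (measurable_fun_fubini_tonelli_G (m1 := m1) _ mJ) => q.
exact: integral_ge0.
Qed.

Lemma measurable_triple_integral_section b : measurable_fun setT
  (fun a => \int[m3]_c g (a, b, c)).
Proof.
have mJ : measurable_fun setT (fun q => \int[m3]_c g (q, c)).
  exact: (measurable_fun_fubini_tonelli_F (m2 := m3) g).
by apply: (measurableT_comp mJ); exact: measurable_fun_pair.
Qed.

(** The vanishing integral is unwound one variable at a time. Nested exceptional sets allow one
    scale [b] to be fixed first, before speaking of almost all shapes [a]. *)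
Lemma triple_integral0 :
  \int[m2]_b \int[m1]_a \int[m3]_c g (a, b, c) = 0 ->
  exists Z : set T2, [/\ measurable Z, m2 Z = 0 &
    forall b, ~ Z b -> exists Y : set T1, [/\ measurable Y, m1 Y = 0 &
      forall a, ~ Y a -> exists X : set T3, [/\ measurable X, m3 X = 0 &
        forall c, ~ X c -> g (a, b, c) = 0]]].
Proof.
move=> I0; have [|Z [mZ Z0 hZ]] := integral0_ae measurable_triple_integral _ I0.
  by move=> b; apply: integral_ge0 => a _; exact: integral_ge0.
exists Z; split => // b /hZ Ib.
have [|Y [mY Y0 hY]] := integral0_ae (measurable_triple_integral_section b) _
  Ib.
  by move=> a; exact: integral_ge0.
exists Y; split => // a /hY Iab; apply: integral0_ae => //.
by apply: (measurableT_comp mg); exact: measurable_fun_pair.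
Qed.

(** With [a] the shape, [b] the scale and [c] the translation, the left side has the order of the
    formula for [mu]; on the right the translation is innermost. *)
Lemma triple_tonelli :
  \int[m3]_c \int[m2]_b \int[m1]_a g (a, b, c) =
  \int[m2]_b \int[m1]_a \int[m3]_c g (a, b, c).
Proof.
pose M (q : T2 * T3) := \int[m1]_a g (a, q.1, q.2).
have M0 q : 0 <= M q by apply: integral_ge0.
rewrite -(fubini_tonelli (m1 := m2) (m2 := m3) M measurable_integral_fst M0).
apply: eq_integral => b _; apply/esym.
apply: (fubini_tonelli (m1 := m1) (m2 := m3) (fun p => g (p.1, b, p.2))) => //.
apply: (measurableT_comp mg); apply: measurable_fun_pair;
  last exact: measurable_snd.
by apply: measurable_fun_pair => //; exact: measurable_fst.
Qed.

End triple_tonelli.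

Section scale_invariance.
Local Open Scope ereal_scope.
Context (R : realType) (n : nat) (L : set 'rV[R]_n.+1 -> 'rV[R]_n.+1).
Local Notation d := n.+1.
Local Notation vec := 'rV[R]_d.
Local Notation leb := (@lebesgue_Rd R n).
Local Notation lam := (@lebesgue_measure R).
Context (F : set (set (set vec))).
Variables (nu : {finite_measure set (sets F) -> \bar R})
  (mu : {measure set (sets F) -> \bar R}).
Hypothesis si : scale_invariant L nu mu.

Local Notation triple := (sets F * measurableTypeR R * Rd R n)%type.

Definition cutoff_strip : set triple := [set p | (0 < p.1.2 < 1)%R].
Local Notation D := cutoff_strip.

Let mD : measurable D.
Proof.
have m : measurable_fun setT (fun p : triple => p.1.2).
  exact: (measurableT_comp measurable_snd measurable_fst).
rewrite (_ : D = setT `&` (fun p : triple => p.1.2) @^-1` `]0%R, 1%R[).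
  by apply: m => //; exact: measurable_itv.
by apply/seteqP; split => p; rewrite /cutoff_strip /= in_itv/=; [move=> ?;
  split|case].
Qed.

Let measurable_fst_section (g : triple -> \bar R) rho x :
  measurable_fun setT g -> measurable_fun setT (fun H => g (H, rho, x)).
Proof.
move=> mg; apply: (measurableT_comp mg); apply: measurable_fun_pair => //.
Qed.

(** [E] stands for a set on which the homothety is measurable; the value 0 outside it makes the
    integrand jointly measurable. *)
Definition disintegrand (E : set triple) (f : sets F -> \bar R) (p : triple) :=
  ((fun p : triple => f (homothet p.1.2 p.2 p.1.1)) \_ E) p *
  (p.1.2 ^- d.+1)%:E.

(** [E] is the strip minus the null set of [suitable_homothet]. Tonelli applies to the integrand cut
    to [E], and nothing is lost: for almost all [x], then almost all [rho], the shapes left out form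
    a [nu]-null set. *)
Lemma disintegration : exists E : set triple,
  [/\ measurable E, E `<=` D,
      \int[lam]_rho \int[nu]_H \int[leb]_x (\1_(D `\` E) (H, rho, x))%:E = 0 &
      forall f, measurable_fun setT f -> (forall G, 0 <= f G) ->
        [/\ measurable_fun setT (disintegrand E f),
            (forall p, 0 <= disintegrand E f p) &
            \int[mu]_G f G =
            \int[lam]_rho \int[nu]_H \int[leb]_x disintegrand E f (H, rho, x)]].
Proof.
have [N [mN N0 mhom]] := suitable_homothet (scale_invariant_suitable si).
set E := D `\` N.
have mE : measurable E by exact: measurableD.
have mN1 : measurable_fun setT (fun p : triple => (\1_(D `&` N) p)%:E : \bar R).
  by apply/measurable_EFinP; apply: measurable_indic; exact: measurableI.
pose v (q : measurableTypeR R * Rd R n) :=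
  \int[nu]_H (\1_(D `&` N) (H, q.1, q.2))%:E.
have mv : measurable_fun setT v.
  by apply: (measurable_integral_fst nu mN1) => p; rewrite lee_fin.
have v0 q : 0 <= v q by apply: integral_ge0 => H _; rewrite lee_fin.
have mNs rho x : measurable [set H : sets F | N (H, rho, x)].
  rewrite -[X in measurable X]setTI.
  have m : measurable_fun setT (fun H : sets F => (H, rho, x) : triple).
    by apply: measurable_fun_pair => //; exact: measurable_fun_pair.
  exact: m.
have vE rho x : (0 < rho < 1)%R -> v (rho, x) = nu [set H | N (H, rho, x)].
  move=> rhoD; rewrite -[in RHS](setIT [set H : sets F | _]) -integral_indic//.
  apply: eq_integral => H _; congr (_%:E); rewrite !indicE.
  by have [NH|NH] := pselect (N (H, rho, x));
    [rewrite !mem_set|rewrite !memNset//= => -[]].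
have vN rho x : ~ (0 < rho < 1)%R -> v (rho, x) = 0.
  move=> rhoD; apply: integral0_eq => H _; rewrite indicE memNset//.
  by move=> [/rhoD].
have I0 : \int[leb]_x \int[lam]_rho v (rho, x) = 0.
  rewrite -[RHS]N0; apply: eq_integral => x _.
  rewrite [RHS]integral_mkcond; apply: eq_integral => rho _; rewrite patchE.
  case: ifPn; rewrite ?inE ?notin_setE/= in_itv/= => rhoD; first exact: vE.
  exact: vN.
exists E; split => //; first exact: subDsetl.
  rewrite setDD -[RHS]I0; apply/esym.
  apply: (triple_tonelli nu lam leb mN1) => p.
  by rewrite lee_fin.
move=> f mf f0.
pose h := (fun p : triple => f (homothet p.1.2 p.2 p.1.1)) \_ E.
have mh : measurable_fun setT h.
  apply/(measurable_restrict _ mE) => //; rewrite setTI.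
  exact: (measurableT_comp mf mhom).
have h0 p : 0 <= h p by rewrite /h patchE; case: ifPn.
have mc : measurable_fun setT (fun p : triple => (p.1.2 ^- d.+1)%:E : \bar R).
  apply/measurable_EFinP; apply: (measurableT_comp (@measurable_invr R)).
  apply: measurable_funX.
  exact: (measurableT_comp measurable_snd measurable_fst).
have c0 rho : (0 < rho < 1)%R -> 0 <= (rho ^- d.+1)%:E :> \bar R.
  by move=> /andP[rho0 _]; rewrite lee_fin invr_ge0 exprn_ge0// ltW.
pose K := disintegrand E f.
have mK : measurable_fun setT K by exact: emeasurable_funM.
have K0 p : 0 <= K p.
  rewrite /K /disintegrand -/h /h patchE; case: ifPn; rewrite ?mul0e// inE.
  by move=> [pD _]; rewrite mule_ge0//; exact: c0.
have KE rho x : (0 < rho < 1)%R ->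
    \int[nu]_H K (H, rho, x) = (\int[nu]_H h (H, rho, x)) * (rho ^- d.+1)%:E.
  move=> rhoD; rewrite -ge0_integralZr//; last exact: c0.
  exact: (measurable_fst_section rho x mh).
have KN rho x : ~ (0 < rho < 1)%R -> \int[nu]_H K (H, rho, x) = 0.
  move=> rhoD; apply: integral0_eq => H _.
  by rewrite /K /disintegrand patchE memNset ?mul0e//= => -[/rhoD].
split => //.
rewrite (scale_invariant_formula si)// -/K.
rewrite -(triple_tonelli nu lam leb mK K0).
(* The integral cut to [E] is the smaller one pointwise. The converse bound holds only off
   exceptional [x], then [rho], then [H]. *)
apply/eqP; rewrite eq_le; apply/andP; split; last first.
  apply: ge0_le_integralT => x; first by apply: integral_ge0 => rho _;
    apply: integral_ge0.
  rewrite [leRHS]integral_mkcond; apply: ge0_le_integralT => rho;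
    first exact: integral_ge0.
  rewrite patchE; case: ifPn; rewrite ?inE ?notin_setE/= in_itv/= => rhoD;
    last first.
    by rewrite KN.
  rewrite KE//; apply: lee_wpmul2r; first exact: c0.
  apply: ge0_le_integralT => // H.
  by rewrite /h patchE; case: ifPn.
have mV : measurable_fun setT (fun x : Rd R n => \int[lam]_rho v (rho, x)).
  exact: (measurable_fun_fubini_tonelli_G (m1 := lam) v mv v0).
have [|Zx [mZx Zx0 hZx]] := integral0_ae mV _ I0.
  by move=> x; apply: integral_ge0.
have F0 x rho : `]0%R, 1%R[%classic rho ->
    0 <= (\int[nu]_H f (homothet rho x H)) * (rho ^- d.+1)%:E.
  by rewrite /= in_itv/= => /c0 c; rewrite mule_ge0// integral_ge0.
apply: (ge0_le_integral_off mZx Zx0) => [x|x|x /hZx V0].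
- by apply: integral_ge0 => rho; exact: F0.
- by apply: integral_ge0 => rho _; exact: integral_ge0.
have mvx : measurable_fun setT (fun rho => v (rho, x)).
  by apply: (measurableT_comp mv); exact: measurable_fun_pair.
have [//|Zr [mZr Zr0 hZr]] := integral0_ae mvx _ V0.
rewrite integral_mkcond.
apply: (ge0_le_integral_off mZr Zr0) => [rho|rho|rho /hZr vr].
- by rewrite patchE; case: ifPn => //; rewrite inE; exact: F0.
- exact: integral_ge0.
rewrite patchE; case: ifPn; rewrite ?inE ?notin_setE/= in_itv/= => rhoD;
  last first.
  exact: integral_ge0.
rewrite KE//; apply: lee_wpmul2r; first exact: c0.
apply: (@ge0_le_integral_off _ _ _ nu [set H | N (H, rho, x)]) => //.
  exact: etrans (esym (vE _ _ rhoD)) vr.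
move=> H NH; rewrite /h patchE mem_set//.
Qed.

Let mleb : measurable_fun setT (fun G : sets F => leb G).
Proof. exact: suitable_volume (scale_invariant_suitable si). Qed.

Let mdiam : measurable_fun setT (fun G : sets F => diam G).
Proof. exact: suitable_diam (scale_invariant_suitable si). Qed.

Lemma measurable_positive_volume :
  measurable ([set G | 0 < leb G] : set (sets F)).
Proof. by rewrite -[X in measurable X]setTI;
  exact: emeasurable_fun_o_infty. Qed.

Lemma measurable_diam1 : measurable ([set G | diam G = 1] : set (sets F)).
Proof.
rewrite -[X in measurable X]setTI; apply: (mdiam _ (emeasurable_set1 1)) => //.
Qed.

Lemma measurable_A1 : measurable (@A1 R n F).
Proof.
have -> : @A1 R n F = [set G : set vec | G 0%R] `&`
    ((fun G : sets F => diam G) @^-1` `[2^-1%:E, 1[).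
  apply/seteqP; split => G; rewrite /A1 /small_sets /= in_itv/=.
    by move=> [_ [G0 dG]].
  by move=> [G0 dG]; split => //; case/andP: dG.
apply: measurableI; first exact: suitable_origin (scale_invariant_suitable si).
by rewrite -[X in measurable X]setTI; apply: mdiam => //;
  exact: emeasurable_itv.
Qed.

Lemma ae_carrier : exists Z : set (sets F), [/\ measurable Z, nu Z = 0 &
  forall H, ~ Z H -> diam H = 1 /\ L H = 0%R].
Proof.
have [Z [mZ Z0 hZ]] := scale_invariant_carrier si.
exists Z; split => // H; apply: contra_notP => HZ; exact: hZ.
Qed.

Lemma mu0_of_nu0 (P Q : set (sets F)) : measurable P -> measurable Q ->
  (forall H rho x, (0 < rho < 1)%R -> P (homothet rho x H) -> Q H) ->
  nu Q = 0 -> mu P = 0.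
Proof.
move=> mP mQ PQ Q0; rewrite -[P in LHS]setIT -integral_indic//.
rewrite (scale_invariant_formula si); last 2 first.
- by apply/measurable_EFinP; exact: measurable_indic.
- by move=> G; rewrite lee_fin.
apply: integral0_eq => x _; apply: integral0_eq => rho;
  rewrite /= in_itv/= => rho01.
rewrite (_ : integral _ _ _ = 0) ?mul0e//.
apply/eqP; rewrite eq_le integral_ge0 ?andbT; last by move=> H _;
  rewrite lee_fin.
rewrite -Q0 -[Q in leRHS]setIT -integral_indic//.
apply: ge0_le_integralT => H; first by rewrite lee_fin.
rewrite lee_fin !indicE; have [PH|PH] := pselect (P (homothet rho x H)).
  by rewrite !mem_set//; exact: PQ PH.
by rewrite memNset.
Qed.

(** In fact [nu Q <= mu P]: the weight [rho ^- (d + 1)] is at least 1, the scales fill an interval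
    of length 1, and the volume of the space is at least that of the unit cube. *)
Lemma nu0_of_mu0 (P Q : set (sets F)) : measurable P -> measurable Q ->
  (forall H rho x, (0 < rho < 1)%R -> Q H -> P (homothet rho x H)) ->
  mu P = 0 -> nu Q = 0.
Proof.
move=> mP mQ PQ P0; apply/eqP; rewrite eq_le measure_ge0 andbT -P0.
rewrite -[P in leRHS]setIT -integral_indic//.
rewrite (scale_invariant_formula si); last 2 first.
- by apply/measurable_EFinP; exact: measurable_indic.
- by move=> G; rewrite lee_fin.
apply: (@le_trans _ _ (\int[leb]_x cst (nu Q) x)).
  rewrite integral_cst// lee_pemulr// (le_trans (leb_unit_cube R n))//.
  exact: le_leb.
apply: ge0_le_integralT => // x.
apply: (@le_trans _ _ (\int[lam]_(rho in `]0%R, 1%R[) cst (nu Q) rho)).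
  rewrite integral_cst; last exact: measurable_itv.
  by rewrite [X in _ * X](_ : _ = 1) ?mule1//=;
    rewrite lebesgue_measure_itv/= lte_fin ltr01 sube0.
apply: ge0_le_integral_in => // rho; rewrite /= in_itv/= => rho01.
rewrite -[leLHS]mule1; apply: lee_pmul => //.
  rewrite -[Q in leLHS]setIT -integral_indic//.
  apply: ge0_le_integralT => H; first by rewrite lee_fin.
  rewrite lee_fin !indicE; have [QH|QH] := pselect (Q H).
    by rewrite !mem_set//; exact: PQ.
  by rewrite memNset.
case/andP: rho01 => rho0 rho1; rewrite lee_fin invf_ge1 ?exprn_gt0//.
by rewrite exprn_ile1// ltW.
Qed.

(** A copy of a set of diameter 1 lies in [A1] exactly when [1/2 <= rho < 1] and it contains the
    origin. At one such scale outside the exceptional ones, almost every [H] in [Q] of diameter 1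
    has only a null set of translations carrying it over the origin, so that [leb H = 0]. *)
Lemma nu0_of_A1 (P Q : set (sets F)) : measurable P ->
  (forall H rho x, (0 < rho < 1)%R -> Q H -> diam H = 1 ->
    P (homothet rho x H)) ->
  mu (@A1 R n F `&` P) = 0 ->
  exists Y : set (sets F), [/\ measurable Y, nu Y = 0 &
    forall H, ~ Y H -> Q H -> diam H = 1 -> leb H = 0].
Proof.
move=> mP PQ P0; set f := fun G : sets F =>
  (\1_(@A1 R n F `&` P) G)%:E : \bar R.
have mA1P : measurable (@A1 R n F `&` P).
  by apply: measurableI => //; exact: measurable_A1.
have mf : measurable_fun setT f by apply/measurable_EFinP;
  exact: measurable_indic.
have f0 G : 0 <= f G by rewrite lee_fin.
have [E [mE ED E0 /(_ f mf f0)[mK K0]]] := disintegration.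
rewrite integral_indic// setIT P0 => /esym KI.
have mDE : measurable_fun setT (fun p : triple => (\1_(D `\` E) p)%:E : \bar R).
  by apply/measurable_EFinP; apply: measurable_indic; exact: measurableD.
have [|Z1 [mZ1 Z10 hZ1]] := triple_integral0 mDE _ E0.
  by move=> p; rewrite lee_fin.
have [Z2 [mZ2 Z20 hZ2]] := triple_integral0 mK K0 KI.
have [rho [/andP[rho2 rho1] nZ]] :
  exists rho, (2^-1 <= rho < 1)%R /\ ~ (Z1 `|` Z2) rho.
  apply: contrapT => /forallNP hall.
  have : lam `[2^-1%R, 1%R[ <= lam (Z1 `|` Z2).
    apply: le_measure.
    - by rewrite inE; exact: measurable_itv.
    - by rewrite inE; exact: measurableU.
    move=> rho; rewrite /= in_itv/= => rho12; apply: contrapT => nZ.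
    by apply: (hall rho).
  rewrite (_ : lam (Z1 `|` Z2) = 0); last by apply: etrans Z10;
    exact: measureU0.
  rewrite lebesgue_measure_itv/= lte_fin ifT; last by lra.
  by rewrite -EFinD lee_fin; lra.
have rho0 : (0 < rho)%R by lra.
have /not_orP[/hZ1[Y1 [mY1 Y10 hY1]] /hZ2[Y2 [mY2 Y20 hY2]]] := nZ.
exists (Y1 `|` Y2); split; first exact: measurableU.
  by rewrite measureU0.
move=> H /not_orP[/hY1[X1 [mX1 X10 hX1]] /hY2[X2 [mX2 X20 hX2]]] QH dH.
(* For [x] outside [X1] the triple lies in [E]. There the integrand is the positive weight
   [rho ^- (d + 1)], so [x] must belong to [X2]. *)
have sub : [set x : vec | homothet rho x H 0%R] `<=` X1 `|` X2.
  move=> x /= xH; apply: contrapT => /not_orP[/hX1 h1 /hX2].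
  have Dx : D (H, rho, x) by rewrite /cutoff_strip /= rho0.
  have Ex : E (H, rho, x).
    apply: contrapT => nE; move: h1; rewrite indicE mem_set//.
    by move=> /eqP; rewrite eqe oner_eq0.
  rewrite /disintegrand patchE mem_set//= /f indicE mem_set/=.
    move/eqP; rewrite mul1e eqe gt_eqF// invr_gt0 exprn_gt0//.
  split; last by apply: PQ => //; rewrite rho0.
  rewrite /A1 /small_sets /= diam_homothet// dH mule1 lte_fin lee_fin.
  by rewrite rho1 rho2.
have W0 : leb [set x : vec | homothet rho x H 0%R] = 0.
  apply/eqP; rewrite eq_le leb_ge0 andbT; apply: le_trans (le_leb sub) _.
  rewrite (_ : leb_outer _ = 0)//; apply: etrans X10.
  exact: (measureU0 mX1 mX2 X20).
have := leb_origin_ge H rho0; rewrite [X in _ <= _ * X]W0 mule0.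
by rewrite pmule_rle0 ?lte_fin ?exprn_gt0// => le0; apply/eqP;
  rewrite eq_le le0 leb_ge0.
Qed.

End scale_invariance.

(** * Divergence of series by comparison with the harmonic series *)

Section series_lemmas.
Local Open Scope ereal_scope.
Context (R : realType).

Lemma nneseries_harmonic : \sum_(k <oo) (@harmonic R k)%:E = +oo.
Proof.
have h0 k : 0 <= (@harmonic R k)%:E by rewrite lee_fin harmonic_ge0.
apply/eqP; rewrite eq_le leey /= leNgt; apply/negP => Soo.
apply: (@dvg_harmonic R); apply: nondecreasing_is_cvgn.
  by apply: nondecreasing_series => k _ _; exact: harmonic_ge0.
exists (fine (\sum_(k <oo) (@harmonic R k)%:E)) => _ [m _ <-].
rewrite -lee_fin fineK ?ge0_fin_numE// ?nneseries_ge0// /series/= -sumEFin.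
exact: nneseries_lim_ge.
Qed.

Lemma nneseries_ge_harmonic (c : R) (a : nat -> \bar R) : (0 < c)%R ->
  (forall k, (c * harmonic k)%:E <= a k) -> \sum_(k <oo) a k = +oo.
Proof.
move=> c0 ca; apply/eqP; rewrite eq_le leey /=.
have : \sum_(k <oo) (c%:E * (@harmonic R k)%:E) = +oo.
  rewrite nneseriesZl => [|k _]; last by rewrite lee_fin harmonic_ge0.
  by rewrite nneseries_harmonic gt0_muley.
move=> <-; apply: lee_nneseries => k _; last by rewrite -EFinM; exact: ca.
by move=> _; rewrite mule_ge0// lee_fin ?harmonic_ge0// ltW.
Qed.

Lemma nneseries_ge_cst (c : \bar R) (a : nat -> \bar R) : 0 < c ->
  (forall k, c <= a k) -> \sum_(k <oo) a k = +oo.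
Proof.
have fin r (b : nat -> \bar R) : (0 < r)%R -> (forall k, r%:E <= b k) ->
    \sum_(k <oo) b k = +oo.
  move=> r0 rb; apply: (nneseries_ge_harmonic r0) => k.
  apply: le_trans (rb k); rewrite lee_fin ler_piMr ?(ltW r0)//.
  by rewrite /harmonic/= invf_le1 ?ler1n.
case: c => [c c0 ca| _ ca|//]; first exact: fin ca.
by apply: (@fin 1%R) => // k; exact: le_trans (leey _) (ca k).
Qed.

End series_lemmas.

Section support_bound.
Local Open Scope ereal_scope.
Context d (T : measurableType d) (R : realType).

Lemma ge0_integral_le_support (m : {measure set T -> \bar R}) (f : T -> \bar R)
    (M : \bar R) : measurable_fun setT f -> (forall x, 0 <= f x <= M) ->
  \int[m]_x f x <= M * m [set x | 0 < f x].
Proof.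
move=> mf f0M; set A := [set x | 0 < f x].
have mA : measurable A.
  by rewrite -[X in measurable X]setTI; exact: emeasurable_fun_o_infty.
rewrite -integral_cst// [leRHS]integral_mkcond; apply: ge0_le_integralT => x.
  by case/andP: (f0M x).
rewrite patchE; case: ifPn => [_|]; first by case/andP: (f0M x).
by rewrite notin_setE /A /= => /negP; rewrite -leNgt.
Qed.

End support_bound.

(** * Implications between thinness, collar integrability and null boundaries *)

Section properties_of_scale_invariant_measures.
Local Open Scope ereal_scope.
Context (R : realType) (n : nat) (L : set 'rV[R]_n.+1 -> 'rV[R]_n.+1).
Local Notation d := n.+1.
Local Notation vec := 'rV[R]_d.
Local Notation leb := (@lebesgue_Rd R n).
Local Notation lam := (@lebesgue_measure R).
Context (F : set (set (set vec))).
Variables (nu : {finite_measure set (sets F) -> \bar R})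
  (mu : {measure set (sets F) -> \bar R}).
Hypothesis si : scale_invariant L nu mu.

Let leb_inner_collar_nd (G : set vec) :
  {homo (fun r => leb (inner_collar G r)) : r s / (r <= s)%R >-> r <= s}.
Proof. by move=> r s rs; apply: le_leb; exact: inner_collar_mono. Qed.

(** The real inverse is 0 at volume 0, so the ratio vanishes there and can be integrated against
    [mu] itself instead of [mu_p]. *)
Let collar_ratio (r : R) (G : sets F) : \bar R :=
  (\1_(@A1 R n F) G)%:E * (leb (inner_collar G r) * ((fine (leb G))^-1)%:E).

Let collar_ratio_ge0 r G : 0 <= collar_ratio r G.
Proof.
by rewrite !mule_ge0// ?lee_fin ?invr_ge0 ?fine_ge0 ?leb_ge0.
Qed.

Let measurable_collar_ratio r : (0 < r)%R ->
  measurable_fun setT (collar_ratio r).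
Proof.
move=> r0; have S := scale_invariant_suitable si.
apply: emeasurable_funM.
  apply/measurable_EFinP; apply: measurable_indic; exact: (measurable_A1 si).
apply: emeasurable_funM; first exact: suitable_collar S _ r0.
apply/measurable_EFinP; apply: (measurableT_comp (@measurable_invr R)).
exact: (measurableT_comp (fine_measurable measurableT) (suitable_volume S)).
Qed.

(* On [A1] the scale [rho] is at least 1/2, so that after division by the volume
   the collar of [rho H + x] of width [r] is at most the collar of [H] of width
   [2 r], whereas the volume cancels against the measure of the translations [x]
   with [0 \in rho H + x]. *)
Lemma integral_collar_ratio_le r : (0 < r)%R ->
  \int[mu]_G collar_ratio r G <=
  (2 ^+ d * 2 ^+ d.+1)%:E * \int[nu]_H leb (inner_collar H (2 * r)%R).
Proof.
move=> r0; have [E [mE ED _ /(_ _ (measurable_collar_ratio r0)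
  (collar_ratio_ge0 r))]] :=
  disintegration si.
move=> [mK K0 ->]; set K := disintegrand E _.
set C := (2 ^+ d * 2 ^+ d.+1)%:E; set J := \int[nu]_H _.
have C0 : 0 <= C by rewrite lee_fin mulr_ge0.
have J0 : 0 <= J by apply: integral_ge0 => H _; exact: leb_ge0.
apply: (@le_trans _ _ (\int[lam]_(rho in `]0%R, 1%R[) cst (C * J) rho));
  last first.
  rewrite integral_cst; last exact: measurable_itv.
  by rewrite [X in _ * X](_ : _ = 1) ?mule1//=;
    rewrite lebesgue_measure_itv/= lte_fin ltr01 sube0.
rewrite [leRHS]integral_mkcond; apply: ge0_le_integralT => rho.
  by apply: integral_ge0 => H _; exact: integral_ge0.
rewrite patchE; case: ifPn; rewrite ?inE ?notin_setE/= in_itv/= => rho01;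
  last first.
  rewrite integral0_eq// => H _; apply: integral0_eq => x _.
  by rewrite /K /disintegrand patchE memNset ?mul0e// => /ED /rho01.
have [rho0 rho1] := andP rho01.
have [Z [mZ Z0 hZ]] := ae_carrier si.
rewrite /J -ge0_integralZl//; last first.
  by apply: (suitable_collar (scale_invariant_suitable si)); rewrite mulr_gt0.
apply: (ge0_le_integral_off mZ Z0) => [H|H|H /hZ[dH _]].
- exact: integral_ge0.
- by rewrite mule_ge0// leb_ge0.
have mKs : measurable_fun setT (fun x => K (H, rho, x)).
  by apply: (measurableT_comp mK); exact: measurable_fun_pair.
have lebH_fin : leb H \is a fin_num.
  rewrite ge0_fin_numE ?leb_ge0//; apply: le_lt_trans (ltry (4 ^+ d)).
  by apply: leb_diam_le1; rewrite dH.
have lebE x : leb (homothet rho x H) = (rho ^+ d)%:E * leb H.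
  exact: leb_homothet.
have collarE x : leb (inner_collar (homothet rho x H) r) =
    (rho ^+ d)%:E * leb (inner_collar H (rho^-1 * r)).
  exact: leb_inner_collar_homothet.
pose M := leb (inner_collar H (2 * r)%R) * ((fine (leb H))^-1)%:E * (2 ^+
  d.+1)%:E.
have [H0|H0] := eqVneq (leb H) 0.
  rewrite integral0_eq; first by rewrite mule_ge0// leb_ge0.
  move=> x _; rewrite /K /disintegrand patchE; case: ifPn;
    rewrite ?mul0e//= => _.
  by rewrite /collar_ratio/= lebE H0 mule0/= invr0 !mule0 mul0e.
have Hgt0 : (0 < fine (leb H))%R.
  by rewrite fine_gt0// lt0e H0 leb_ge0 ltey_eq lebH_fin.
(* For fixed [H] and [rho] the integral over [x] is at most [M] times the volume of the translations
   whose copy contains the origin. In [M], the bound [rho >= 1/2] yields both the width [2 * r] and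
   the factor [2 ^ (d + 1)]. *)
have KM x : 0 <= K (H, rho, x) <= M /\
    (0 < K (H, rho, x) -> homothet rho x H 0%R).
  rewrite K0/= /K /disintegrand patchE; case: ifPn => _; rewrite ?mul0e;
    last first.
    by split; rewrite ?ltxx// !mule_ge0 ?leb_ge0// lee_fin ?invr_ge0
      ?exprn_ge0// ltW.
  rewrite /collar_ratio /= indicE.
  have [hA|nA] := pselect ((@A1 R n F) (homothet rho x H)); last first.
    rewrite memNset// !mul0e; split; rewrite ?ltxx//.
    by rewrite !mule_ge0 ?leb_ge0// lee_fin ?invr_ge0 ?exprn_ge0// ltW.
  rewrite mem_set//; case: hA => _ [oH].
  rewrite diam_homothet// dH mule1 lee_fin => /andP[rho2 _].
  split=> //; rewrite mul1e /M; apply: lee_pmul.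
  - by rewrite mule_ge0// ?leb_ge0// lee_fin invr_ge0 fine_ge0// leb_ge0.
  - by rewrite lee_fin invr_ge0 exprn_ge0// ltW.
  - rewrite collarE lebE.
    rewrite -{1}(fineK lebH_fin) -EFinM /= invfM [X in X * _]muleC -muleA
      -EFinM.
    rewrite mulrA divff ?expf_neq0 ?gt_eqF// mul1r.
    apply: lee_wpmul2r; first by rewrite lee_fin invr_ge0 ltW.
    apply: leb_inner_collar_nd; apply: ler_wpM2r; first exact: ltW.
    by rewrite -[leRHS]invrK lef_pV2// ?posrE ?invr_gt0.
  - rewrite lee_fin -exprVn; apply: lerXn2r;
    rewrite ?nnegrE ?invr_ge0 ?(ltW rho0)//.
    by rewrite -[leRHS]invrK lef_pV2// ?posrE ?invr_gt0.
apply: (le_trans (ge0_integral_le_support leb mKs (fun x => (KM x).1))).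
have M0 : 0 <= M.
  by rewrite !mule_ge0 ?leb_ge0// lee_fin ?invr_ge0 ?exprn_ge0// ltW.
(* The volume of these translations is at most [2 ^ d * leb H], as [rho < 1]; the factor [leb H]
   cancels the denominator of [M]. *)
apply: (@le_trans _ _ (M * ((2 ^+ d)%:E * leb H))).
  apply: lee_wpmul2l => //.
  apply: (@le_trans _ _ (leb [set x : vec | homothet rho x H 0%R])).
    by apply: le_leb => x; case: (KM x).
  apply: le_trans (leb_origin_le H rho0) _.
  apply: lee_wpmul2r; first exact: leb_ge0.
  by rewrite lee_fin ler_piMr ?exprn_ge0// exprn_ile1// ltW.
rewrite /M -{2}(fineK lebH_fin) -!muleA [leRHS]muleC; apply: lee_wpmul2l.
  exact: leb_ge0.
rewrite -!EFinM lee_fin le_eqVlt; apply/orP; left; apply/eqP.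
by field; rewrite gt_eqF.
Qed.

Let mV : measurable ([set G | 0 < leb G] : set (sets F)).
Proof. exact: (measurable_positive_volume si). Qed.

Let mu_pE f :
  \int[mu_p mu]_(G in @A1 R n F) f G = \int[mrestr mu mV]_(G in @A1 R n F) f G.
Proof. by []. Qed.

Let collar_integrand (G : sets F) :=
  \int[lam]_(r in `]0%R, 1%R[) (r^-1%:E * (leb (inner_collar G r) / leb G)).

Let ratio_ge0 (G : set vec) r : 0 <= leb (inner_collar G r) / leb G.
Proof. by rewrite mule_ge0 ?inve_ge0 ?leb_ge0. Qed.

Let ratio_nd (G : set vec) :
  {homo (fun r => leb (inner_collar G r) / leb G) :
    r s / (r <= s)%R >-> r <= s}.
Proof.
move=> r s rs; apply: lee_wpmul2r; first by rewrite inve_ge0 leb_ge0.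
exact: leb_inner_collar_nd.
Qed.

Let collar_integrand_ge0 G : 0 <= collar_integrand G.
Proof.
apply: integral_ge0 => r; rewrite /= in_itv/= => /andP[r0 _].
by rewrite mule_ge0// lee_fin invr_ge0 ltW.
Qed.

Let A1_volume (G : sets F) : @A1 R n F G -> leb G < +oo.
Proof.
move=> [dG _]; apply: le_lt_trans (ltry (4 ^+ d)).
exact/leb_diam_le1/ltW.
Qed.

(** The sum [S] is a measurable majorant of the inner integral over [r] on the sets of [A1] with
    positive volume, by [dyadic_ge]. Its integral is the given series. *)
Lemma collar_integrable_of_series :
  \sum_(k <oo) \int[mu]_G collar_ratio (2^-1 ^+ k) G < +oo ->
  collar_integrable mu.
Proof.
apply: le_lt_trans; rewrite -integral_nneseries//; last first.
  by move=> k; apply: measurable_collar_ratio; rewrite exprn_gt0.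
pose S (G : sets F) := \sum_(k <oo) collar_ratio (2^-1 ^+ k) G.
rewrite -/S.
have S0 G : 0 <= S G by apply: nneseries_ge0.
have mS : measurable_fun setT S.
  apply: ge0_emeasurable_sum => k //.
  by move=> _; apply: measurable_collar_ratio; rewrite exprn_gt0.
rewrite mu_pE; apply: (@le_trans _ _ (\int[mrestr mu mV]_G S G)); last first.
  apply: ge0_le_measure_integral => // A mA; rewrite /= /mrestr.
  by apply: le_measure; rewrite ?inE//; exact: measurableI.
rewrite integral_mkcond; apply: (@ge0_le_integral_off _ _ _ (mrestr mu mV) (~`
  [set G | 0 < leb G] : set (sets F))).
- exact: measurableC.
- by rewrite /= /mrestr setICl measure0.
- by move=> G; rewrite patchE; case: ifPn => // _; exact: collar_integrand_ge0.
- exact: S0.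
move=> G /contrapT V0; rewrite patchE; case: ifPn; rewrite ?inE// => AG.
apply: (le_trans (dyadic_ge (ratio_ge0 G) (@ratio_nd G))).
apply: lee_nneseries => k _ //.
rewrite /collar_ratio indicE mem_set// mul1e le_eqVlt; apply/orP; left;
  apply/eqP.
congr (_ * _); have Gfin : leb G \is a fin_num by rewrite ge0_fin_numE
  ?leb_ge0// A1_volume.
by rewrite -{1}(fineK Gfin) inver gt_eqF// fine_gt0// V0 A1_volume.
Qed.

(** By [dyadic_le], a divergent series of collars makes the inner integral of (I) infinite, so the
    copies in question are negligible in [A1]. This serves both for compact sets and for refuting
    (I) in the last counterexample. *)
Lemma nu0_of_collar_integrable (Q : set (sets F)) :
  (forall H rho x, (0 < rho < 1)%R -> Q H -> diam H = 1 ->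
    \sum_(k <oo) leb (inner_collar (homothet rho x H) (2^-1 ^+ k.+1)) = +oo) ->
  collar_integrable mu ->
  exists Y : set (sets F), [/\ measurable Y, nu Y = 0 &
    forall H, ~ Y H -> Q H -> diam H = 1 -> leb H = 0].
Proof.
move=> Qoo CI.
pose S (G : sets F) := \sum_(k <oo) leb (inner_collar G (2^-1 ^+ k.+1)).
have mS : measurable_fun setT S.
  apply: ge0_emeasurable_sum => k; first by move=> G _ _; exact: leb_ge0.
  move=> _; apply: (suitable_collar (scale_invariant_suitable si)).
  by rewrite exprn_gt0.
(* A measurable event that contains the copies of every set in [Q] of diameter 1 and positive
   volume. *)
pose P : set (sets F) := [set G : sets F | 0 < leb G] `&` S @^-1` [set +oo].
have mP : measurable P.
  apply: measurableI => //; rewrite -[X in measurable X]setTI.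
  by apply: mS => //; exact: emeasurable_set1.
have P0 : mu (@A1 R n F `&` P) = 0.
  have mAP : measurable (@A1 R n F `&` P).
    by apply: measurableI => //; exact: (measurable_A1 si).
  have : mrestr mu mV (@A1 R n F `&` P) = 0.
    apply: (@integral_infty_set _ _ _ _ _ (collar_integrand \_ (@A1 R n F))
      mAP).
    - by move=> G; rewrite patchE; case: ifPn => // _;
      exact: collar_integrand_ge0.
    - move=> G [AG [V0 SG]]; rewrite patchE mem_set//.
      apply/eqP; rewrite eq_le leey /=.
      apply: le_trans (dyadic_le (ratio_ge0 G) (@ratio_nd G)).
      have Gfin : leb G \is a fin_num by rewrite ge0_fin_numE ?leb_ge0//
        A1_volume.
      have Gpos : (0 < fine (leb G))%R by rewrite fine_gt0// V0 A1_volume.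
      have iE : (leb G)^-1 = ((fine (leb G))^-1)%:E.
        by rewrite -{1}(fineK Gfin) inver gt_eqF.
      have -> : \sum_(k <oo) (leb (inner_collar G (2^-1 ^+ k.+1)) / leb G) =
          ((fine (leb G))^-1)%:E * S G.
        rewrite -nneseriesZl; last by move=> k _; exact: leb_ge0.
        by apply: eq_eseriesr => k _; rewrite muleC iE.
      by rewrite (_ : S G = +oo)// !gt0_muley// lte_fin invr_gt0.
    - by rewrite -integral_mkcond -mu_pE.
  by rewrite /= /mrestr setIidl// => G [_ []].
have [Y [mY Y0 hY]] : exists Y : set (sets F), [/\ measurable Y, nu Y = 0 &
    forall H, ~ Y H -> (Q H /\ 0 < leb H) -> diam H = 1 -> leb H = 0].
  apply: (nu0_of_A1 si mP) P0 => H rho x rho01 [QH H0] dH; split;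
    last exact: Qoo.
  case/andP: (rho01) => rho0 _; rewrite /= (leb_homothet x H rho0 : leb _ = _).
  by rewrite mule_gt0// lte_fin exprn_gt0.
exists Y; split => // H nY QH dH; apply/eqP; rewrite eq_le leb_ge0 andbT leNgt.
by apply/negP => H0; have := hY H nY (conj QH H0) dH => H00; move: H0;
  rewrite H00 ltxx.
Qed.

(** Positive volume is preserved by homotheties, so it is negligible for [mu] as well, and [mu_p] is
    the zero measure. *)
Lemma collar_integrable_of_null_volume :
  nu [set H | 0 < leb H] = 0 -> collar_integrable mu.
Proof.
move=> V0; have muV0 : mu [set H | 0 < leb H] = 0.
  apply: (mu0_of_nu0 si mV mV) V0 => H rho x /andP[rho0 _].
  rewrite /= (leb_homothet x H rho0 : leb _ = _).
  by rewrite pmule_rgt0// lte_fin exprn_gt0.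
rewrite /collar_integrable mu_pE integral_mkcond.
apply: (@le_lt_trans _ _ (\int[mrestr mu mV]_G cst 0 G)).
  apply: (@ge0_le_integral_off _ _ _ (mrestr mu mV) setT) => //.
    by rewrite /= /mrestr setTI.
  - by move=> G; rewrite patchE; case: ifPn => // _;
    exact: collar_integrand_ge0.
  - by move=> G /(_ I).
by rewrite [X in X < _](_ : _ = 0); [exact: ltry|exact: integral0].
Qed.

Let mdiam1 := measurable_diam1 si.

Let mboundary : measurable_fun setT (fun G : sets F => leb (boundary G)).
Proof. exact: (suitable_boundary (scale_invariant_suitable si)). Qed.

Let mB : measurable ([set G | 0 < leb (boundary G)] : set (sets F)).
Proof. by rewrite -[X in measurable X]setTI;
  exact: emeasurable_fun_o_infty. Qed.

Let boundary_homothet_gt0 rho x H : (0 < rho)%R ->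
  (0 < leb (boundary (homothet rho x H))) = (0 < leb (boundary H)).
Proof.
move=> rho0; rewrite boundary_homothet// (leb_homothet _ _ rho0 : leb _ = _).
by rewrite pmule_rgt0// lte_fin exprn_gt0.
Qed.

Let mSmall : measurable ([set G | small_sets G] : set (sets F)).
Proof.
rewrite -[X in measurable X]setTI; apply: emeasurable_fun_infty_o => //.
exact: (suitable_diam (scale_invariant_suitable si)).
Qed.

Lemma null_boundary_of_nu0 :
  nu [set H | 0 < leb (boundary H)] = 0 -> null_boundary mu.
Proof.
apply: (mu0_of_nu0 si) => //; first exact: measurableI.
by move=> H rho x /andP[rho0 _] [_]; rewrite /= boundary_homothet_gt0.
Qed.

(** The condition [diam H = 1] is what places the copies of [H] in [small_sets]. *)
Lemma nu0_of_null_boundary :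
  null_boundary mu -> nu [set H | diam H = 1 /\ 0 < leb (boundary H)] = 0.
Proof.
apply: (nu0_of_mu0 si) => //; [exact: measurableI|exact: measurableI|].
move=> H rho x /andP[rho0 rho1] [dH bH]; split.
  by rewrite /small_sets /= diam_homothet// dH mule1 lte_fin.
by rewrite /= boundary_homothet_gt0.
Qed.

Let parallel_integral r := \int[nu]_H leb (outer_parallel H r `\`
  inner_parallel H r).

Let parallel_integral_ge0 r : 0 <= parallel_integral r.
Proof. by apply: integral_ge0 => H _; exact: leb_ge0. Qed.

Let parallel_integral_nd :
  {homo parallel_integral : r s / (r <= s)%R >-> r <= s}.
Proof.
move=> r s rs; apply: ge0_le_integralT => H; first exact: leb_ge0.
exact/le_leb/parallel_mono.
Qed.

Let thin_series : thin nu ->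
  \sum_(k <oo) parallel_integral (2^-1 ^+ k.+1) < +oo.
Proof.
have := dyadic_le parallel_integral_ge0 parallel_integral_nd.
move=> /le_lt_trans h /h; rewrite lte_pdivrMl// => /lt_le_trans; apply.
by rewrite leey.
Qed.

Lemma thin_null_boundary : thin nu -> null_boundary mu.
Proof.
move=> /thin_series Soo; apply: null_boundary_of_nu0.
have b0 : \int[nu]_H leb (boundary H) = 0.
  apply/eqP; rewrite eq_le integral_ge0 ?andbT; last by move=> *;
    exact: leb_ge0.
  rewrite leNgt; apply/negP => c0; move: Soo.
  rewrite (nneseries_ge_cst c0) ?ltxx// => k.
  apply: ge0_le_integralT => H; first exact: leb_ge0.
  by apply/le_leb/boundary_parallel; rewrite exprn_gt0.
have [H|Z [mZ Z0 hZ]] := integral0_ae mboundary _ b0; first exact: leb_ge0.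
apply: (subset_measure0 _ mZ _ Z0) => // H /= bH.
by apply: contrapT => /hZ bH0; move: bH; rewrite bH0 ltxx.
Qed.

Lemma thin_collar_integrable : thin nu -> collar_integrable mu.
Proof.
move=> /thin_series Soo; apply: collar_integrable_of_series.
pose J k := \int[nu]_H leb (inner_collar H (2 * 2^-1 ^+ k)%R).
have J0 k : 0 <= J k by apply: integral_ge0 => *; exact: leb_ge0.
have Jfin k : J k < +oo.
  have [Z [mZ Z0 hZ]] := ae_carrier si.
  apply: (@le_lt_trans _ _ (\int[nu]_H cst (4 ^+ d)%:E H)).
    apply: (ge0_le_integral_off mZ Z0) => [H|H|H /hZ[dH _]].
    - exact: leb_ge0.
    - by rewrite lee_fin.
    apply: (@le_trans _ _ (leb H)).
      by apply: le_leb; rewrite inner_collarE; exact: subIsetl.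
    by apply: leb_diam_le1; rewrite dH.
  rewrite integral_cst// lte_mul_pinfty// ?lee_fin//.
  by rewrite ltey_eq fin_num_measure.
have JS : \sum_(k <oo) J k < +oo.
  (* The doubled widths start at 2 and 1, while the series given by thinness starts at [1/2]. The
     first two terms are finite because almost all shapes have diameter 1 and [nu] is finite. *)
  rewrite (@nneseries_split _ J 0 2); last by move=> k _; exact: J0.
  rewrite -(nneseries_addn 2 J0) big_mkord !big_ord_recr big_ord0 /= add0e.
  apply: lte_add_pinfty; first by apply: lte_add_pinfty; exact: Jfin.
  apply: le_lt_trans Soo; apply: lee_nneseries => k _; first by move=> _;
    exact: J0.
  apply: ge0_le_integralT => H; first exact: leb_ge0.
  rewrite (_ : 2 * _ = 2^-1 ^+ k.+1)%R; last first.
    by rewrite addn2 exprS mulrA divff// mul1r.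
  by apply/le_leb/inner_collar_parallel; rewrite exprn_gt0.
apply: (@le_lt_trans _ _ (\sum_(k <oo) (2 ^+ d * 2 ^+ d.+1)%:E * J k)).
  apply: lee_nneseries => k _; first by move=> _; exact: integral_ge0.
  by apply: integral_collar_ratio_le; rewrite exprn_gt0.
by rewrite nneseriesZl// lte_mul_pinfty// lee_fin.
Qed.

Lemma compact_collar_null_boundary :
  compactly_supported mu -> collar_integrable mu -> null_boundary mu.
Proof.
move=> [C [mC C0 hC]] CI; have S := scale_invariant_suitable si.
have mcpt := suitable_compact S.
have cpt0 : nu (~` [set H | compact H]) = 0.
  have cpt0 : mu (~` [set H | compact H]) = 0.
    by apply: (subset_measure0 _ mC _ C0) => //; exact: measurableC.
  apply: (nu0_of_mu0 si) cpt0 => //; [exact: measurableC|exact: measurableC|].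
  by move=> H rho x /andP[rho0 _] /=; rewrite compact_homothet.
pose Q : set (sets F) := [set H | compact H /\ 0 < leb (boundary H)].
have [H rho x rho01 [cH bH] dH|Y [mY Y0 hY]] :=
  @nu0_of_collar_integrable Q _ CI.
  have /andP[rho0 rho1] := rho01.
  have : 0 < leb (boundary (homothet rho x H)) by rewrite boundary_homothet_gt0.
  move=> /nneseries_ge_cst; apply => k.
  apply/le_leb/boundary_inner_collar; first by rewrite compact_homothet.
  by rewrite exprn_gt0.
have [Z [mZ Z0 hZ]] := ae_carrier si.
apply: null_boundary_of_nu0.
have mC' : measurable (~` [set H | compact H] :
  set (sets F)) by exact: measurableC.
have mCZ : measurable ((~` [set H | compact H] : set (sets F)) `|` Z).
  exact: measurableU.
have CZ0 : nu ((~` [set H | compact H] : set (sets F)) `|` Z) = 0.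
  by apply: etrans cpt0; exact: measureU0.
apply: (subset_measure0 mB (measurableU _ _ mY mCZ)); last first.
  by apply: etrans Y0; exact: measureU0.
move=> H /= bH; apply: contrapT =>
  /not_orP[nY /not_orP[/contrapT cH /hZ[dH _]]].
have lebH := hY H nY (conj cH bH) dH.
(* (I) yields only [leb H = 0]; compactness turns this into a contradiction, as [H] contains its
   boundary. *)
suff : leb (boundary H) <= leb H by rewrite lebH leNgt bH.
apply: le_leb; apply: subset_trans (boundary_inner_collar cH ltr01) _.
by rewrite inner_collarE; exact: subIsetl.
Qed.

End properties_of_scale_invariant_measures.

(** * Measures carried by the copies of one set *)

Section product_sigma_finite.
Local Open Scope ereal_scope.
Context d1 d2 (T1 : measurableType d1) (T2 : measurableType d2) (R : realType).
Variables (m1 : {sigma_finite_measure set T1 -> \bar R})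
  (m2 : {sigma_finite_measure set T2 -> \bar R}).

(* On [m1 \x m2] itself, the search for a sigma-finite structure finds only the
   instance of the library for subprobabilities. *)
Definition sigma_finite_product : set (T1 * T2)%type -> \bar R := m1 \x m2.

HB.instance Definition _ := Measure.on sigma_finite_product.

Lemma sigma_finite_productP : sigma_finite setT sigma_finite_product.
Proof.
have [A AT Afin] := sigma_finiteT m1; have [B BT Bfin] := sigma_finiteT m2.
exists (fun k => if unpickle k is Some (i, j) then A i `*` B j else set0).
  apply/seteqP; split => // -[x y] _.
  have [i _ Aix] : (\bigcup_i A i) x by rewrite -AT.
  have [j _ Bjy] : (\bigcup_j B j) y by rewrite -BT.
  by exists (pickle (i, j)) => //; rewrite pickleK.
move=> k; case: (unpickle k) => [[i j]|]; last first.
  by split => //; rewrite measure0.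
have [mA Aoo] := Afin i; have [mB Boo] := Bfin j.
split; first exact: measurableX.
by rewrite /sigma_finite_product product_measure1E// lte_mul_pinfty//
  ge0_fin_numE.
Qed.

HB.instance Definition _ := Measure_isSigmaFinite.Build _ _ _
  sigma_finite_product sigma_finite_productP.

End product_sigma_finite.

Section one_shape.
Local Open Scope ereal_scope.
Context (R : realType) (n : nat) (L : set 'rV[R]_n.+1 -> 'rV[R]_n.+1).
Local Notation d := n.+1.
Local Notation vec := 'rV[R]_d.
Local Notation leb := (@lebesgue_Rd R n).
Local Notation lam := (@lebesgue_measure R).
Local Notation pair := (Rd R n * measurableTypeR R)%type.
Variable H0 : set vec.
Hypothesis diam_H0 : diam H0 = 1.
Hypothesis L_H0 : L H0 = 0%R.
Hypothesis mO : measurable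
  ([set p | (0 < p.2 < 1)%R /\ homothet p.2 p.1 H0 0%R] : set pair).

(* Outside the range of scales the shape is sent to the empty set, on which all
   the functions that have to be measurable vanish. *)
Definition copy (p : pair) : set vec :=
  if (0 < p.2 < 1)%R then homothet p.2 p.1 H0 else set0.

(** The largest sigma-algebra for which [copy] is measurable. A map out of it is measurable once its
    composite with [copy] is, so each requirement becomes one on [(x, rho)]. *)
Definition final_sets : set (set (set vec)) :=
  [set A | measurable (copy @^-1` A)].
Local Notation F := final_sets.

Lemma sigma_algebra_final_sets : sigma_algebra setT F.
Proof.
split; rewrite /final_sets /=.
- by rewrite preimage_set0.
- by move=> A mA; rewrite setTD preimage_setC; exact: measurableC.
- by move=> A mA; rewrite preimage_bigcup; exact: bigcup_measurable.
Qed.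

Lemma measurable_final (A : set (sets F)) :
  measurable A = measurable (copy @^-1` A).
Proof.
by rewrite /measurable /= (sigma_algebra_id sigma_algebra_final_sets).
Qed.

Lemma measurable_copy : measurable_fun setT (copy : pair -> sets F).
Proof. by move=> _ A; rewrite measurable_final setTI. Qed.

Lemma measurable_fun_final dT (T : measurableType dT) (g : sets F -> T) :
  measurable_fun setT (g \o copy) -> measurable_fun setT g.
Proof.
by move=> mg _ B mB; rewrite setTI measurable_final -comp_preimage -[X in
  measurable X]setTI; exact: mg.
Qed.

Let mscale : measurable ([set p | (0 < p.2 < 1)%R] : set pair).
Proof.
rewrite (_ : mkset _ = setT `&` (fun p : pair => p.2) @^-1` `]0%R, 1%R[).
  by apply: measurable_snd => //; exact: measurable_itv.
by apply/seteqP; split => p; rewrite /= in_itv/=; [move=> ?; split|case].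
Qed.

(** Diameters and volumes are invariant under translations, so on the copies they depend on the
    scale only. *)
Lemma measurable_fun_scale (g : sets F -> \bar R) (kappa : R -> \bar R) :
  measurable_fun [set: measurableTypeR R] kappa -> g set0 = 0 ->
  (forall rho x, (0 < rho < 1)%R -> g (homothet rho x H0) = kappa rho) ->
  measurable_fun setT g.
Proof.
move=> mk g0 gk; apply: measurable_fun_final.
rewrite (_ : g \o copy = (fun p : pair =>
  kappa p.2) \_ [set p | (0 < p.2 < 1)%R]).
  apply/(measurable_restrict _ mscale) => //; rewrite setTI.
  exact/measurable_funTS/(measurableT_comp mk).
apply/funext => p; rewrite /copy patchE /=; case: ifPn => p2.
  by rewrite mem_set// gk.
by rewrite memNset//; exact/negP.
Qed.

Let copy_neq p : copy p <> H0.
Proof.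
rewrite /copy; case: ifPn => [/andP[p0 p1]|_] H0E; move: diam_H0.
  rewrite -{1}H0E diam_homothet// diam_H0 mule1 => -[p2].
  by move: p1; rewrite p2 ltxx.
rewrite -H0E /diam => d0; have :
  ereal_sup (0%E |` [set (euclid_norm (x - y))%:E | x in @set0 vec & y in
    set0]) <= 0 :> \bar R.
  by apply: ge_ereal_sup => _ [->//|[x []]].
by rewrite d0 lee_fin ler10.
Qed.

(** Every copy has diameter less than 1, so none equals [H0] and the preimage under [copy] is
    empty. *)
Lemma measurable_H0 : measurable ([set H0] : set (sets F)).
Proof.
rewrite measurable_final (_ : _ @^-1` _ = set0)//.
by apply/seteqP; split => // p /= /copy_neq.
Qed.

Definition shape : {finite_measure set (sets F) -> \bar R} := \d_(H0 : sets F).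

Lemma shapeE A : shape A = (\1_A (H0 : sets F))%:E.
Proof. by []. Qed.

(** The region below the weight: its section over a scale [rho] has length [rho ^- (d + 1)].
    Restricting the product of Lebesgue measures to it and forgetting the last coordinate yields the
    density in the formula for [mu]. *)
Let subgraph : set (pair * measurableTypeR R) :=
  [set p | (0 < p.1.2 < 1)%R /\ (0 < p.2 < p.1.2 ^- d.+1)%R].

Let msubgraph : measurable subgraph.
Proof.
have m1 : measurable_fun setT (fun p : pair * measurableTypeR R => p.1.2).
  exact: (measurableT_comp measurable_snd measurable_fst).
rewrite (_ : subgraph = [set p | (0 < p.1.2)%R && (p.1.2 < 1)%R && (0 < p.2)%R
  &&
    (p.2 < p.1.2 ^- d.+1)%R]); last first.
  apply/seteqP; split => p; rewrite /subgraph /=.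
    by move=> [/andP[-> ->] /andP[-> ->]].
  by move=> /andP[/andP[/andP[-> ->] ->] ->].
pose b (p : pair * measurableTypeR R) :=
  (0 < p.1.2)%R && (p.1.2 < 1)%R && (0 < p.2)%R &&
    (p.2 < p.1.2 ^- d.+1)%R.
suff mb : measurable_fun setT b by rewrite -[X in measurable X]setTI; exact: mb.
apply: measurable_and.
  apply: measurable_and; [apply: measurable_and|]; exact: measurable_fun_ltr.
apply: measurable_fun_ltr => //.
apply: (measurableT_comp (@measurable_invr R)).
exact: measurable_funX.
Qed.

Lemma copies_exists : exists mu : {measure set (sets F) -> \bar R},
  forall f, measurable_fun setT f -> (forall G, 0 <= f G) ->
    \int[mu]_G f G = \int[leb]_x \int[lam]_(rho in `]0%R, 1%R[)
      (f (homothet rho x H0) * (rho ^- d.+1)%:E).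
Proof.
pose P := sigma_finite_product leb lam \x lam.
pose phi (p : pair * measurableTypeR R) : sets F := copy p.1.
have mphi : measurable_fun setT phi by exact: (measurableT_comp
  measurable_copy).
unshelve eexists.
  refine (pushforward (mrestr P msubgraph) phi : {measure set _ -> \bar R}).
  exact: mphi.
move=> f mf f0 /=; rewrite ge0_integral_pushforward//.
have mfphi : measurable_fun setT (f \o phi) by exact: measurableT_comp.
rewrite preimage_setT integral_mrestr//; last by move=> p; exact: f0.
rewrite integral_mkcond; set g := (f \o phi) \_ subgraph.
have mg : measurable_fun setT g.
  by apply/(measurable_restrict _ msubgraph) => //; exact: measurable_funTS.
have g0 p : 0 <= g p by rewrite /g patchE; case: ifPn => // _; exact: f0.
rewrite (fubini_tonelli1 (m1 := sigma_finite_product leb lam) (m2 :=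
  lam) g mg g0).
have mG := measurable_fun_fubini_tonelli_F (m2 := lam) g mg g0.
rewrite (fubini_tonelli1 (m1 := leb) (m2 := lam) _ mG); last first.
  by move=> q; apply: integral_ge0 => t _; exact: g0.
apply: eq_integral => x _; rewrite [RHS]integral_mkcond.
apply: eq_integral => rho _; rewrite patchE /fubini_F.
case: ifPn; rewrite ?inE ?notin_setE/= in_itv/= => rho01; last first.
  by apply: integral0_eq => t _; rewrite /g patchE memNset// => -[/rho01].
have [rho0 rho1] := andP rho01.
transitivity (\int[lam]_(t in `]0%R,
  rho ^- d.+1[) cst (f (homothet rho x H0)) t).
  rewrite [RHS]integral_mkcond; apply: eq_integral => t _; rewrite /g !patchE.
  have [t0|t0] := pselect (0 < t < rho ^- d.+1)%R.
    have gt : subgraph ((x, rho), t) by [].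
    rewrite (mem_set gt) mem_set /=; last by rewrite in_itv.
    by rewrite /phi /copy /= rho01.
  have gt : ~ subgraph ((x, rho), t) by move=> [_ /t0].
  by rewrite (memNset gt) memNset //= in_itv.
rewrite integral_cst; last exact: measurable_itv.
rewrite [X in _ * X](_ : _ = (rho ^- d.+1)%:E)//= lebesgue_measure_itv/=
  lte_fin.
by rewrite invr_gt0 exprn_gt0// sube0.
Qed.

(** Needed for [f] composed with a homothety, whose measurability is not at hand: [f] is compared
    with a constant off the null complement of [H0]. *)
Let dirac_integral f : (forall G, 0 <= f G) -> \int[shape]_H f H = f H0.
Proof.
move=> f0; transitivity (\int[shape]_H cst (f H0) H); last first.
  rewrite integral_cst// [X in _ * X](_ : _ = 1) ?mule1//.
  by apply: etrans (shapeE _) _; rewrite indicE mem_set.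
have mZ : measurable (~` [set H0] : set (sets F)).
  by apply: measurableC; exact: measurable_H0.
have Z0 : shape (~` [set H0] : set (sets F)) = 0.
  by apply: etrans (shapeE _) _; rewrite indicE memNset//=; apply.
apply/eqP; rewrite eq_le; apply/andP; split;
  apply: (ge0_le_integral_off mZ Z0) => [H|H|H /contrapT ->] //=; exact: f0.
Qed.

Let homothet_leb rho x A : (0 < rho)%R ->
  leb (homothet rho x A) = (rho ^+ d)%:E * leb A.
Proof. exact: leb_homothet. Qed.

Let mpow : measurable_fun [set: measurableTypeR R] (fun rho =>
  (rho ^+ d)%:E : \bar R).
Proof. by apply/measurable_EFinP; exact: measurable_funX. Qed.

Let mscaled (psi : R -> \bar R) r : {homo psi : s t / (s <= t)%R >-> s <= t} ->
  measurable_fun [set: measurableTypeR R]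
    (fun rho => (rho ^+ d)%:E * psi (rho^-1 * r)%R).
Proof.
move=> nd; apply: emeasurable_funM => //.
apply: (measurableT_comp (nondecreasing_emeasurable nd)).
by apply: measurable_funM => //; exact: measurable_invr.
Qed.

Let leb0 : leb set0 = 0. Proof. exact: (outer_measure0 (@leb_outer R n)). Qed.

Let outer_parallel0 r : outer_parallel (set0 : set vec) r = set0.
Proof. by apply/seteqP; split => // x /dist_lt[y []]. Qed.

Let boundary0 : boundary (set0 : set vec) = set0.
Proof. by rewrite boundaryE closure0 set0I. Qed.

Lemma suitable_shape : suitable shape.
Proof.
have mCH0 : measurable (~` [set H0] : set (sets F)).
  by apply: measurableC; exact: measurable_H0.
split.
- exact: sigma_algebra_final_sets.
- apply: (@measurable_fun_scale _ (fun rho => rho%:E)).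
  + exact/measurable_EFinP.
  + by apply/eqP; rewrite eq_le diam_ge0 andbT;
    apply: ge_ereal_sup => _ [->//|[x []]].
  + by move=> rho x /andP[rho0 _]; rewrite diam_homothet// diam_H0 mule1.
- rewrite measurable_final (_ : _ @^-1` _ =
    [set p | (0 < p.2 < 1)%R /\ homothet p.2 p.1 H0 0%R])//.
  apply/seteqP; split => p; rewrite /copy /=; first by case: ifPn.
  by move=> [->].
(* Homotheties preserve compactness: the preimage is everything if [H0] is compact, and otherwise
   the complement of the strip, where [copy] is the empty set. *)
- rewrite measurable_final; have [cH|cH] := pselect (compact H0).
    rewrite (_ : _ @^-1` _ = setT)//; apply/seteqP; split => // p _;
      rewrite /copy /=.
    by case: ifPn => [/andP[p0 _]|_];
      [rewrite compact_homothet|exact: compact0].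
  rewrite (_ : _ @^-1` _ = ~` [set p | (0 < p.2 < 1)%R]);
    first exact: measurableC.
  apply/seteqP; split => p; rewrite /copy /=.
    by case: ifPn => // /andP[p0 _]; rewrite compact_homothet.
  by move=> /negP/negPf ->; exact: compact0.
- apply: (@measurable_fun_scale _ (fun rho => (rho ^+ d)%:E * leb H0)) => //.
    exact: emeasurable_funM.
  by move=> rho x /andP[rho0 _]; exact: homothet_leb.
- apply: (@measurable_fun_scale _ (fun rho =>
  (rho ^+ d)%:E * leb (boundary H0))).
  + exact: emeasurable_funM.
  + by rewrite boundary0.
  + by move=> rho x /andP[rho0 _]; rewrite boundary_homothet// homothet_leb.
- move=> r r0; pose psi r := leb (inner_collar H0 r).
  apply: (@measurable_fun_scale _ (fun rho =>
    (rho ^+ d)%:E * psi (rho^-1 * r)%R)).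
  + by apply: mscaled => s t st; apply: le_leb; exact: inner_collar_mono.
  + by rewrite inner_collarE set0I.
  + by move=> rho x /andP[rho0 _]; exact: leb_inner_collar_homothet.
- move=> r r0; pose psi r := leb (outer_parallel H0 r `\` inner_parallel H0 r).
  apply: (@measurable_fun_scale _ (fun rho =>
    (rho ^+ d)%:E * psi (rho^-1 * r)%R)).
  + by apply: mscaled => s t st; apply: le_leb; exact: parallel_mono.
  + by rewrite outer_parallel0 set0D.
  + by move=> rho x /andP[rho0 _]; exact: leb_parallel_homothet.
have m1 : measurable_fun setT (fun p : sets F * R * Rd R n => p.1.1).
  exact: (measurableT_comp measurable_fst measurable_fst).
have m2 : measurable_fun setT (fun p : sets F * R * Rd R n =>
  (p.2, p.1.2) : pair).
  apply: measurable_fun_pair; first exact: measurable_snd.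
  exact: (measurableT_comp measurable_snd measurable_fst).
(* All shapes except [H0] are discarded, being null for the unit mass. On [H0] the homothety is
   [copy], measurable by the choice of the sigma-algebra. *)
exists [set p | p.1.1 <> H0]; split.
- by rewrite -[X in measurable X]setTI; exact: (m1 measurableT _ mCH0).
- apply: integral0_eq => x _; apply: integral0_eq => rho _.
  by apply: etrans (shapeE _) _; rewrite indicE memNset//=; apply.
move=> mD Y mY; rewrite (_ : _ `&` _ =
    ((fun p : sets F * R * Rd R n => p.1.1) @^-1` [set H0]) `&`
    ((fun p : sets F * R * Rd R n => (p.2, p.1.2)) @^-1`
      ((copy @^-1` Y) `&` [set p | (0 < p.2 < 1)%R]))).
  apply: measurableI; rewrite -[X in measurable X]setTI.
    by apply: m1 => //; exact: measurable_H0.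
  by apply: m2 => //; apply: measurableI => //; move: mY;
    rewrite measurable_final.
apply/seteqP; split => -[[H rho] x] /=.
  by move=> [[rho01 /contrapT ->]]; rewrite /copy /= rho01.
by move=> [->]; rewrite /copy /= => -[+ rho01]; rewrite rho01 => ?;
  split=> //; split=> //; apply.
Qed.

Lemma one_shape_scale_invariant : exists mu : {measure set (sets F) -> \bar R},
  scale_invariant L shape mu.
Proof.
have [mu muE] := copies_exists; exists mu; split.
- exact: suitable_shape.
- exists (~` [set H0]); split.
  + by apply: measurableC; exact: measurable_H0.
  + by apply: etrans (shapeE _) _; rewrite indicE memNset//=; apply.
  + by move=> H /= HN HH; apply: HN; rewrite HH.
move=> f mf f0; rewrite muE//; apply: eq_integral => x _;
  apply: eq_integral => rho _.
congr (_ * _); apply/esym.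
exact: (dirac_integral (fun H => f0 (homothet rho x H))).
Qed.

End one_shape.

(** * Slabs *)

Section slabs.
Context (R : realType) (n : nat).
Local Notation d := n.+1.
Local Notation vec := 'rV[R]_d.
Local Notation leb := (@leb_outer R n).
Implicit Types (T : set R) (x y : vec) (t : R).

Definition slab T : set vec :=
  [set x | T (x ord0 ord0) /\ forall i, 0 < x ord0 i < 1].

Definition set_first x t : vec := \row_i if i == ord0 then t else x ord0 i.

Lemma set_first_slab T x t : slab T x -> T t -> 0 < t < 1 ->
  slab T (set_first x t).
Proof.
move=> [_ x01] Tt t01; split=> [|i]; rewrite mxE ?eqxx//.
by case: eqP.
Qed.

Lemma euclid_norm_set_first x t :
  euclid_norm (x - set_first x t) = `|x ord0 ord0 - t|.
Proof.
rewrite /euclid_norm (bigD1 ord0)//= !mxE eqxx big1 ?addr0 ?sqrtr_sqr//.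
by move=> i /negPf i0; rewrite !mxE i0 subrr expr0n.
Qed.

Lemma closure_set_first x t (A : set vec) :
  (forall e : R, 0 < e -> exists2 u, `|t - u| < e & A (set_first x u)) ->
  closure A (set_first x t).
Proof.
move=> h B /nbhs_ballP[e /= e0 eB]; have [u tu Au] := h e e0.
exists (set_first x u); split => //; apply: eB; split=> // i j.
rewrite !mxE; case: eqP => _; first exact: tu.
exact: ballxx.
Qed.

Lemma coord_near x i (U : set R) : open U -> U (x ord0 i) ->
  \forall y \near x, U ((y : vec) ord0 i).
Proof.
move=> oU Ux; have := @coord_continuous R 1 d ord0 i x.
by apply; exact: open_nbhs_nbhs.
Qed.

Lemma slab_subset_interior T : open T -> slab T `<=` interior (slab T).
Proof.
move=> oT x [Tx x01].
have h1 : \forall y \near x, T ((y : vec) ord0 ord0) by exact: coord_near.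
have h2 : \forall y \near x, forall i, 0 < (y : vec) ord0 i < 1.
  apply: (@filter_forall vec 'I_d (fun i (y : vec) =>
    0 < y ord0 i < 1) (nbhs x) (nbhs_filter x)) => i.
  have oI : open (`]0, 1[%classic : set R) by exact: interval_open.
  have := @coord_near x i _ oI; rewrite /= in_itv/= => /(_ (x01 i)).
  by apply: filterS => y; rewrite /= in_itv.
by apply: filterS2 h1 h2 => y; split.
Qed.

Lemma closure_slab T x i : closure (slab T) x -> 0 <= x ord0 i <= 1.
Proof.
move=> clx; apply/andP; split; rewrite leNgt; apply/negP => xi.
  have oU : open [set t : R | t < 0] by exact: open_lt.
  by have [y [[_ /(_ i)/andP[y0 _]] /(lt_trans y0)]] :=
    clx _ (coord_near oU xi);
    rewrite ltxx.
have oU : open [set t : R | 1 < t] by exact: open_gt.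
by have [y [[_ /(_ i)/andP[_ y1]] /= /(lt_trans y1)]] :=
  clx _ (coord_near oU xi);
  rewrite ltxx.
Qed.

(** For open [T] the points of the slab are interior, so a boundary point has a coordinate 0 or 1 or
    lies on one of countably many slices. *)
Lemma leb_boundary_slab T : open T -> countable (`]0, 1[ `\` T) ->
  leb (boundary (slab T)) = 0%E.
Proof.
move=> oT cT; apply/eqP; rewrite eq_le leb_ge0 andbT.
(* [inord] lists the finitely many pairs of faces as a sequence over [nat], with harmless
   repetitions. *)
pose F k : set vec := [set x : vec | [set 0; 1] (x ord0 (inord k))].
pose S : set vec := [set x : vec | (`]0, 1[ `\` T) (x ord0 ord0)].
apply: (@le_trans _ _ (leb (\bigcup_k F k `|` S))); last first.
  apply: (le_trans (outer_measureU2 leb _ _)).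
  have F0 k : leb (F k) = 0%E.
    by apply: leb_countable_slices; exact: finite_set_countable.
  by rewrite [X in (X + _)%E](leb_bigcup0 F0) [X in (_ +
    X)%E](leb_countable_slices _ cT) adde0.
apply: le_leb => x [clx nint].
have [[k xk]|nF] := pselect (exists k, F k x); first by left; exists k.
right; have x01 i : 0 < x ord0 i < 1.
  have /andP[x0 x1] := closure_slab i clx.
  rewrite !lt_neqAle x0 x1 !andbT eq_sym.
  by apply/andP; split; apply/eqP => xi; apply: nF; exists i;
    rewrite /F /= inord_val; [left|right].
split; first by rewrite /= in_itv/= x01.
by move=> Tx; apply: nint; exact: slab_subset_interior.
Qed.

(** The open box with sides [sigma, 1, ..., 1] is covered by this part of the slab and countably
    many null slices. *)
Lemma leb_slab_ge T (sigma : R) :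
  0 <= sigma <= 1 -> countable (`]0, 1[ `\` T) ->
  (sigma%:E <= leb (slab T `&` [set x | (x ord0 ord0 < sigma)%R]))%E.
Proof.
move=> /andP[s0 s1] cT.
have := @leb_open_box R n (fun k => if k is 0 then sigma else 1) _.
rewrite big_ord_recl/= big1// mulr1 => h.
apply: le_trans (h _) _; first by case.
set B := [set x | _].
apply: (@le_trans _ _ (leb ((slab T `&` [set x | x ord0 ord0 < sigma]) `|`
    [set x : vec | (`]0, 1[ `\` T) (x ord0 ord0)]))).
  apply: le_leb => x xB; have x01 i : 0 < x ord0 i < 1.
    have /andP[-> /=] := xB i; case: (val i) => // /lt_le_trans; exact.
  have [Tx|Tx] := pselect (T (x ord0 ord0)); last by right; split=> //=;
    rewrite in_itv/=.
  by left; split => //; have /andP[] := xB ord0.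
apply: (le_trans (outer_measureU2 leb _ _)).
by rewrite [X in (_ + X)%E](leb_countable_slices _ cT) adde0.
Qed.

End slabs.

(** * Cut points with small gaps that decrease only logarithmically *)

Section log_points.
Context (R : realType).

(** The summand 1 makes the sequence start at 1. Gaps of size at most [1 / (k + 1)] bring the cuts
    within that distance below the [k]-th point, yet at [k + 1 = 2 ^ m] this point is still at least
    [1 / (m + 1)]. *)
Definition log_point (k : nat) : R := (1 + ln k.+1%:R)^-1.

Let den_ge1 k : 1 <= 1 + ln k.+1%:R :> R.
Proof. by rewrite lerDl ln_ge0// ler1n. Qed.

Let den_gt0 k : 0 < 1 + ln k.+1%:R :> R.
Proof. exact: lt_le_trans ltr01 (den_ge1 k). Qed.

Lemma log_point0 : log_point 0 = 1.
Proof. by rewrite /log_point ln1 addr0 invr1. Qed.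

Lemma log_point_gt0 k : 0 < log_point k.
Proof. by rewrite invr_gt0. Qed.

Lemma log_point_le j k : (j <= k)%N -> log_point k <= log_point j.
Proof.
move=> jk; rewrite lef_pV2 ?posrE// lerD2l ler_ln ?posrE ?ltr0n//.
by rewrite ler_nat.
Qed.

Lemma log_point_lt k : log_point k.+1 < log_point k.
Proof.
by rewrite ltf_pV2 ?posrE// ltrD2l ltr_ln ?posrE ?ltr0n// ltr_nat.
Qed.

(** The gap is the difference of the logarithms times two points that are at most 1, and
    [ln (1 + 1 / (k + 1)) <= 1 / (k + 1)]. *)
Lemma log_point_gap k : log_point k - log_point k.+1 <= k.+1%:R^-1.
Proof.
have lnle : ln k.+2%:R - ln k.+1%:R <= k.+1%:R^-1 :> R.
  rewrite -ln_div ?posrE ?ltr0n// -[k.+2%:R]natr1 mulrDl divff ?pnatr_eq0//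
    mul1r.
  by apply: le_ln1Dx; apply: lt_trans (ltrN10 R) _; rewrite invr_gt0 ltr0n.
apply: le_trans lnle.
have -> : log_point k - log_point k.+1 = (ln k.+2%:R - ln k.+1%:R) * (log_point
  k * log_point k.+1).
  by rewrite /log_point; field; rewrite !gt_eqF.
apply: ler_piMr; first by rewrite subr_ge0 ler_ln ?posrE ?ltr0n// ler_nat.
by apply: mulr_ile1; rewrite ?(ltW (log_point_gt0 _))// invf_le1.
Qed.

Lemma log_point_pow2 m : m.+1%:R^-1 <= log_point (2 ^ m).-1.
Proof.
rewrite /log_point prednK ?expn_gt0// lef_pV2 ?posrE ?ltr0n//; last first.
  by rewrite -(prednK (expn_gt0 2 m)).
rewrite natrX lnXn// -[m.+1%:R]natr1 addrC lerD2r -[leLHS]mulr_natl.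
rewrite ler_piMr//; apply: (@le_ln1Dx R 1).
by apply: lt_trans (ltrN10 R) ltr01.
Qed.

Definition log_intervals : set R :=
  \bigcup_k `]log_point k.+1, log_point k[%classic.

Lemma open_log_intervals : open log_intervals.
Proof. by apply: bigcup_open => k _; exact: interval_open. Qed.

Lemma log_intervals_point k : ~ log_intervals (log_point k).
Proof.
move=> [j _]; rewrite /= in_itv/= => /andP[jk kj].
have [kj'|jk'] := leqP k j.
  by have := lt_le_trans kj (log_point_le kj'); rewrite ltxx.
by have := lt_le_trans jk (log_point_le jk'); rewrite ltxx.
Qed.

Lemma log_intervals_cover : `]0, 1[ `\` log_intervals `<=` range log_point.
Proof.
move=> t [/=]; rewrite in_itv/= => /andP[t0 t1] nt.
have ex : exists k, log_point k <= t.
  (* With [k] the integer part of [exp (1 / t)], the denominator [1 + ln (k + 1)] exceeds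
     [1 / t]. *)
  exists (Num.truncn (expR t^-1));
    rewrite -[leRHS]invrK lef_pV2 ?posrE ?invr_gt0//.
  rewrite (@le_trans _ _ (ln (expR t^-1)))//; first by rewrite expRK.
  rewrite (@le_trans _ _ (ln (Num.truncn (expR t^-1)).+1%:R))//;
    last by rewrite lerDr.
  by rewrite ler_ln ?posrE ?expR_gt0 ?ltr0n// ltW// truncnS_gt.
case: (ex_minnP ex) => [[|k] kt kmin].
  by move: t1; rewrite ltNge -log_point0 kt.
exists k.+1 => //; apply/eqP; rewrite eq_le kt leNgt; apply/negP => kt'.
apply: nt; exists k => //=; rewrite in_itv/= kt'/= ltNge; apply/negP => /kmin.
by rewrite ltnn.
Qed.

Lemma countable_log_gaps : countable (`]0, 1[ `\` log_intervals).
Proof.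
exact: card_le_trans (subset_card_le log_intervals_cover) (card_image_le _ _).
Qed.

End log_points.

Section log_slab.
Context (R : realType) (n : nat).
Local Notation d := n.+1.
Local Notation vec := 'rV[R]_d.
Local Notation leb := (@leb_outer R n).
Local Notation H := (@slab R n (@log_intervals R)).

(** The first coordinate of [x] lies between the points of index [i + 1] and [i], for some [i >= k].
    Moving it down to the lower one reaches the boundary within the gap, which is at most
    [1 / (i + 1)]. *)
Lemma log_slab_collar k r : k.+1%:R^-1 <= r ->
  H `&` [set x | x ord0 ord0 < log_point R k] `<=` inner_collar H r.
Proof.
move=> kr x [Hx /= xk]; split=> //; have [[i _ /=]] := Hx.
rewrite in_itv/= => /andP[ix xi] x01.
have ki : (k <= i)%N.
  rewrite leqNgt; apply/negP => /(@log_point_le R) /(lt_le_trans xk)/(lt_trans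
    ix).
  by rewrite ltxx.
apply/dist_lt; exists (set_first x (log_point R i.+1)); last first.
  rewrite euclid_norm_set_first ger0_norm ?subr_ge0 ?(ltW ix)//.
  apply: lt_le_trans kr; apply: (@lt_le_trans _ _ (log_point R i - log_point R
    i.+1)).
    by rewrite ltrD2r.
  apply: le_trans (log_point_gap R i) _.
  by rewrite lef_pV2 ?posrE ?ltr0n// ler_nat.
split; last first.
  move=> /interior_subset[]; rewrite mxE eqxx.
  by move=> /log_intervals_point.
apply: closure_set_first => e e0.
pose g := x ord0 ord0 - log_point R i.+1; have g0 : 0 < g by rewrite subr_gt0.
(* The cut point is approached from above; the minimum with [g] keeps the approximation in the
   interval of [x]. *)
exists (log_point R i.+1 + Num.min (e / 2) g).
  rewrite opprD addNKr normrN gtr0_norm ?lt_min ?divr_gt0//.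
  by rewrite gt_min ltr_pdivrMr// mulr_natr mulr2n ltrDl e0.
have m0 : 0 < Num.min (e / 2) g by rewrite lt_min divr_gt0.
have mg : log_point R i.+1 + Num.min (e / 2) g <= x ord0 ord0.
  by rewrite -lerBrDl ge_min lexx orbT.
apply: set_first_slab => //.
  by exists i => //=; rewrite in_itv/= ltrDl m0 (le_lt_trans mg).
have /andP[_ x1] := x01 ord0.
by rewrite (le_lt_trans mg)// andbT addr_gt0// log_point_gt0.
Qed.

Lemma leb_log_slab_collar m r : 2^-1 ^+ m <= r ->
  (m.+1%:R^-1%:E <= leb (inner_collar H r))%E.
Proof.
move=> mr; apply: (@le_trans _ _ (log_point R (2 ^ m).-1)%:E).
  by rewrite lee_fin log_point_pow2.
have pos : 0 <= log_point R (2 ^ m).-1 <= 1.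
  by rewrite (ltW (log_point_gt0 _ _))/= -(log_point0 R) log_point_le.
apply: (le_trans (leb_slab_ge n pos (@countable_log_gaps R))).
apply: le_leb; apply: log_slab_collar.
by rewrite prednK ?expn_gt0// natrX -exprVn.
Qed.

(** If [2^-m <= c], the [k]-th collar has volume at least [1 / (m + k + 1)], hence at least
    [1 / ((m + 1) (k + 1))]. The factor [c] absorbs the rescaling of the slab and of its copies. *)
Lemma log_slab_collar_series (c : R) : 0 < c ->
  (\sum_(k <oo) leb (inner_collar H (c * 2^-1 ^+ k)) = +oo)%E.
Proof.
move=> c0; have [m mc] := exists_half_pow_le c0.
have m0 : 0 < (m.+1%:R)^-1 :> R by rewrite invr_gt0 ltr0n.
apply: (nneseries_ge_harmonic m0) => k.
apply: (@le_trans _ _ ((m + k).+1%:R^-1)%:E); last first.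
  by apply: leb_log_slab_collar; rewrite exprD ler_wpM2r// exprn_ge0.
rewrite lee_fin /harmonic/= -invfM lef_pV2 ?posrE ?mulr_gt0 ?ltr0n//.
by rewrite -natrM ler_nat; nia.
Qed.

End log_slab.

(** * Scale invariant measures generated by a slab *)

Section slab_example.
Local Open Scope ereal_scope.
Context (R : realType) (n : nat) (L : set 'rV[R]_n.+1 -> 'rV[R]_n.+1).
Local Notation d := n.+1.
Local Notation vec := 'rV[R]_d.
Hypothesis L_anchor : anchor L.

Lemma slab_scale_invariant (T : set R) (s t : R) : measurable T ->
  T s -> (0 < s < 1)%R -> T t -> (0 < t < 1)%R -> s != t ->
  exists (F : set (set (set vec))) (nu :
    {finite_measure set (sets F) -> \bar R})
    (mu : {measure set (sets F) -> \bar R}) (c : R) (z : vec),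
    [/\ scale_invariant L nu mu, (0 < c)%R, diam (homothet c z (slab T)) = 1 &
      forall A : set (sets F), nu A = (\1_A (homothet c z (slab T) :
        sets F))%:E].
Proof.
move=> mT Ts s01 Tt t01 st; set H := @slab R n T.
pose x0 : vec := const_mx (2^-1)%R.
have xs u : T u -> (0 < u < 1)%R -> H (set_first x0 u).
  by move=> Tu u01; split => [|i]; rewrite !mxE ?eqxx//; case: eqP => // _; lra.
have dfin : diam H \is a fin_num.
  rewrite ge0_fin_numE ?diam_ge0//;
    apply: (@le_lt_trans _ _ (Num.sqrt d%:R)%:E); last exact: ltry.
  apply: ge_ereal_sup => _ [->|[x [_ x01] [y [_ y01] <-]]].
    by rewrite lee_fin sqrtr_ge0.
  rewrite lee_fin; apply: ler_wsqrtr.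
  rewrite -[X in (_ <= X%:R)%R]card_ord -sumr_const; apply: ler_sum => i _.
  rewrite !mxE -[leRHS](expr1n _ 2) -real_normK ?num_real//.
  apply: lerXn2r; rewrite ?nnegrE// ler_norml.
  by have := x01 i; have := y01 i; lra.
have dpos : (0 < fine (diam H))%R.
  rewrite fine_gt0// ltey_eq dfin/= andbT.
  have := le_diam (xs s Ts s01) (xs t Tt t01); apply: lt_le_trans.
  rewrite lte_fin; apply: lt_le_trans (norm_coord_le _ ord0).
  by rewrite !mxE eqxx normr_gt0 subr_eq0.
set c := ((fine (diam H))^-1)%R; have c0 : (0 < c)%R by rewrite invr_gt0.
set z : vec := (- (c *: L H))%R.
have Hz : diam (homothet c z H) = 1.
  by rewrite diam_homothet// -(fineK dfin) -EFinM mulVf ?gt_eqF.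
have LHz : L (homothet c z H) = 0%R.
  rewrite L_anchor// ?subrr//; first by exists (set_first x0 s); exact: xs.
  by rewrite ltey_eq dfin.
have mO : measurable
    ([set p | (0 < p.2 < 1)%R /\ homothet p.2 p.1 (homothet c z H) 0%R]
      : set (Rd R n * measurableTypeR R)).
  (* The coordinates of the point of the original slab that the two homotheties send to the
     origin. *)
  pose y i (p : Rd R n * measurableTypeR R) : R :=
    ((c^-1 *: (p.2^-1 *: (0 - (p.1 : vec)) - z)) ord0 i)%R.
  have my i : measurable_fun setT (y i).
    rewrite (_ : y i = fun p => c^-1 * (p.2^-1 * (0 - (p.1 :
      vec) ord0 i) - z ord0 i))%R;
      last by apply/funext => p; rewrite /y !mxE.
    apply: measurable_funM => //; apply: measurable_funB => //.
    apply: measurable_funM.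
      exact: (measurableT_comp (@measurable_invr R) measurable_snd).
    apply: measurable_funB => //.
    exact: (measurableT_comp (@measurable_coord R n i) measurable_fst).
  rewrite (_ : mkset _ = (snd @^-1` `]0%R, 1%R[) `&` (y ord0 @^-1` T `&`
      \bigcap_(i in setT) (y i @^-1` `]0%R, 1%R[))); last first.
    apply/seteqP; split => p.
      move=> [p01]; have /andP[p0 _] := p01.
      rewrite homothetE//= homothetE//= => -[Ty y01].
      split; first by rewrite /= in_itv.
      by split => // i _; rewrite /= in_itv/=; exact: y01.
    rewrite /= in_itv/= => -[p01 [Ty y01]]; split => //;
      have /andP[p0 _] := p01.
    rewrite homothetE//= homothetE//=; split => // i.
    by have := y01 i I; rewrite /= in_itv.
  apply: measurableI; first by rewrite -[X in measurable X]setTI;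
    apply: measurable_snd => //; exact: measurable_itv.
  apply: measurableI; first by rewrite -[X in measurable X]setTI; exact: my.
  apply: fin_bigcap_measurable => // i _.
  by rewrite -[X in measurable X]setTI; apply: my => //; exact: measurable_itv.
have [mu si] := one_shape_scale_invariant Hz LHz mO.
by exists (final_sets (homothet c z H)), (shape (homothet c z H)), mu, c, z.
Qed.

End slab_example.

Theorem proposition1p3 (R : realType) (n : nat)
    (L : set 'rV[R]_n.+1 -> 'rV[R]_n.+1) (L_anchor : anchor L) :
  [/\ (forall (F : set (set (set 'rV[R]_n.+1)))
              (nu : {finite_measure set (sets F) -> \bar R})
              (mu : {measure set (sets F) -> \bar R}),
         scale_invariant L nu mu -> thin nu ->
         null_boundary mu /\ collar_integrable mu),
      (forall (F : set (set (set 'rV[R]_n.+1)))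
              (nu : {finite_measure set (sets F) -> \bar R})
              (mu : {measure set (sets F) -> \bar R}),
         scale_invariant L nu mu -> compactly_supported mu ->
         collar_integrable mu -> null_boundary mu),
      (exists (F : set (set (set 'rV[R]_n.+1)))
              (nu : {finite_measure set (sets F) -> \bar R})
              (mu : {measure set (sets F) -> \bar R}),
         [/\ scale_invariant L nu mu, collar_integrable mu &
             ~ null_boundary mu]) &
      (exists (F : set (set (set 'rV[R]_n.+1)))
              (nu : {finite_measure set (sets F) -> \bar R})
              (mu : {measure set (sets F) -> \bar R}),
         [/\ scale_invariant L nu mu, null_boundary mu &
             ~ collar_integrable mu])].
Proof.
split.
- move=> F nu mu si th.
  by split; [exact: thin_null_boundary si th|exact: thin_collar_integrable si
    th].
- by move=> F nu mu si; exact: compact_collar_null_boundary si.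
- pose T : set R := range ratr.
  have cT : countable T by exact: card_le_trans (card_image_le _ _) (countableP
    _).
  have mT : measurable T by apply: countable_measurable => // t;
    exact: measurable_set1.
  have T2 : T 2^-1 by exists (2^-1 : rat) => //; rewrite fmorphV rmorph_nat.
  have T3 : T 3^-1 by exists (3^-1 : rat) => //; rewrite fmorphV rmorph_nat.
  have [|||F [nu [mu [c [z [si c0 d1 nuE]]]]]] :=
    slab_scale_invariant L_anchor mT T2 _ T3.
  + by lra.
  + by lra.
  + by apply/eqP; lra.
  have H0 : leb_outer (slab T : set 'rV[R]_n.+1) = 0%E.
    apply/eqP; rewrite eq_le leb_ge0 andbT -(@leb_countable_slices R n ord0 T
      cT).
    by apply: le_leb => x [].
  have bH : (0 < leb_outer (boundary (slab T : set 'rV[R]_n.+1)))%E.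
    apply: (@lt_le_trans _ _ 1%E) => //; apply: (le_trans (leb_unit_cube R n)).
    (* By density of the rationals every point of the cube is in the closure of the slab, and
       interior points belong to the slab. As the slab is null, its boundary has at least the volume
       of the cube. *)
    apply: (@le_trans _ _ (leb_outer (boundary (slab T) `|` slab T))).
      apply: le_leb => x x01; have [|nint] := pselect (interior (slab T) x).
        by move=> /interior_subset; right.
      left; split => //.
      have -> : x = set_first x (x ord0 ord0).
        by apply/rowP => i; rewrite mxE; case: eqP => // ->.
      apply: closure_set_first => e e0; have /andP[x0 x1] := x01 ord0.
      have /rat_in_itvoo[q] : x ord0 ord0 < Num.min 1 (x ord0 ord0 + e).
        by rewrite lt_min x1 ltrDl.
      rewrite in_itv/= lt_min => /andP[xq /andP[q1 qe]]; exists (ratr q).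
        by rewrite ltr0_norm ?subr_lt0// opprB ltrBlDl.
      split=> [|i]; rewrite mxE; first by exists q.
      by case: eqP => // _; rewrite q1 (lt_trans x0).
    apply: (le_trans (outer_measureU2 (@leb_outer R n) _ _)).
    by rewrite [X in (_ + X)%E]H0 adde0.
  exists F, nu, mu; split => //.
    apply: (collar_integrable_of_null_volume si).
    rewrite nuE indicE memNset//= => /=.
    by rewrite (leb_homothet _ _ c0 : lebesgue_Rd _ = _) H0 mule0 ltxx.
  move=> /(nu0_of_null_boundary si); rewrite nuE indicE mem_set/=.
    by move=> /eqP; rewrite eqe oner_eq0.
  split=> //; rewrite boundary_homothet// (leb_homothet _ _ c0 :
    lebesgue_Rd _ = _).
  by rewrite mule_gt0// lte_fin exprn_gt0.
- have oT := @open_log_intervals R.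
  have mT := open_measurable oT.
  have lt k := @log_point_lt R k; have gt0 k := @log_point_gt0 R k.
  have e0 := log_point0 R.
  (* The two points are the midpoints of the first two intervals. *)
  have [|||||F [nu [mu [c [z [si c0 d1 nuE]]]]]] :=
    @slab_scale_invariant R n L L_anchor
    (@log_intervals R) ((log_point R 1 + log_point R 0) / 2)
    ((log_point R 2 + log_point R 1) / 2) mT.
  + by exists 0 => //=; rewrite in_itv/=; have := lt 0; lra.
  + by have := lt 0; have := gt0 1%N; lra.
  + by exists 1 => //=; rewrite in_itv/=; have := lt 1%N; lra.
  + by have := lt 0; have := lt 1%N; have := gt0 2%N; lra.
  + by apply/eqP; have := lt 0; have := lt 1%N; lra.
  exists F, nu, mu; split => //.
    apply: (null_boundary_of_nu0 si); rewrite nuE indicE memNset//= => /=.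
    rewrite boundary_homothet// (leb_homothet _ _ c0 : lebesgue_Rd _ = _).
    by rewrite (leb_boundary_slab n oT (@countable_log_gaps R)) mule0 ltxx.
  move=> /(@nu0_of_collar_integrable _ _ _ _ _ _ si [set (homothet c z (slab
    (@log_intervals R)))]).
  case.
    move=> H rho x /andP[rho0 _] -> _.
    (* Width [2^-(k + 1)] on a copy of scale [rho] of the normalized slab is width
       [(c^-1 * rho^-1 / 2) * 2^-k] on the slab itself. *)
    have cE : 0 < c^-1 * rho^-1 / 2 by rewrite divr_gt0// mulr_gt0 ?invr_gt0.
    have := log_slab_collar_series n cE.
    have pos : 0 < rho ^+ n.+1 * c ^+ n.+1 by rewrite mulr_gt0 ?exprn_gt0.
    move=> /(congr1 (fun y => ((rho ^+ n.+1 * c ^+ n.+1)%:E * y)%E)).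
    rewrite gt0_muley ?lte_fin// => <-.
    rewrite -nneseriesZl => [|k _]; last exact: leb_ge0.
    apply: eq_eseriesr => k _.
    apply: etrans (leb_inner_collar_homothet _ _ _ rho0) _.
    rewrite leb_inner_collar_homothet// EFinM muleA;
      congr (_ * leb_outer (inner_collar _ _))%E.
    by rewrite exprS; ring.
  (* The null set [Y] misses the only atom of [nu], so (I) would make the shape null, whereas the
     slab has volume at least 1. *)
  move=> Y [mY Y0 hY].
  have nY : ~ Y (homothet c z (slab (@log_intervals R))).
    move=> YH; move: Y0; rewrite nuE indicE mem_set//= => /eqP.
    by rewrite eqe oner_eq0.
  have := hY _ nY erefl d1.
  rewrite (leb_homothet _ _ c0 : lebesgue_Rd _ = _) => /eqP.
  rewrite gt_eqF// mule_gt0// ?lte_fin ?exprn_gt0//.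
  apply: (@lt_le_trans _ _ 1%E) => //.
  have one : 0 <= (1 : R) <= 1 by rewrite ler01 lexx.
  have := leb_slab_ge n one (@countable_log_gaps R); move=> /le_trans; apply.
  by apply: le_leb; exact: subIsetl.
Qed.
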